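(* Let $n>1$, let $M$ be the Hardy-Littlewood maximal operator on $\mathbb{R}^n$ (centred or non-centred), and let $u \in W^{1,1}(\mathbb{R}^{n})$. Let $$A = \Big\{x \in \mathbb{R}^{n} : \liminf_{\delta \to 0} \int_{B(x,\delta)} M|\nabla u| \, dy = \infty \Big\}.$$ Then for each $i \in \{1,\ldots,n\}$ the distributional partial derivative $\partial_i Mu$ is represented by a function $h_i \in L^{1,\infty}(\mathbb{R}^{n})$ when acting on smooth functions with compact support not meeting $A$, that is, $$-\int_{\mathbb{R}^n} Mu \; \partial_i \varphi \, dx = \int_{\mathbb{R}^n} h_i \, \varphi \, dx$$ for all $\varphi \in C_0^\infty(\mathbb{R}^n)$ with $\operatorname{supp}\varphi \cap A = \varnothing$. Moreover, there is a constant $C$ depending only on $n$ such that $$|h_i| \leq C\, M|\nabla u| \quad \text{almost everywhere}, \quad i \in \{1,\ldots,n\}.$$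
   Context: Cubes are open with sides parallel to the coordinate axes. The non-centred Hardy-Littlewood maximal function of $f \in L^1_{loc}(\mathbb{R}^n)$ is $Mf(x) = \sup_{Q \ni x} \frac{1}{|Q|}\int_Q |f|\,dy$, supremum over all cubes $Q$ containing $x$; the centred one uses only cubes centred at $x$. $B(x,\delta)$ is the open ball with centre $x$ and radius $\delta$. $L^{1,\infty}(\mathbb{R}^n)$ is the space of measurable functions $f$ with $\sup_{\lambda>0} \lambda\, |\{x \in \mathbb{R}^n : |f(x)|>\lambda\}| < \infty$. *)

(* Defs.v *)
From HB Require Import structures.
From mathcomp Require Import all_boot all_order all_algebra.
From mathcomp Require Import all_classical all_reals all_analysis.

Set Implicit Arguments.
Unset Strict Implicit.
Unset Printing Implicit Defensive.
Import Order.TTheory GRing.Theory Num.Theory.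
Import numFieldNormedType.Exports.
Local Open Scope classical_set_scope.
Local Open Scope ring_scope.

(* R^n is 'rV[R]_n, which the library equips with the topology of the sup norm
   but with no sigma-algebra. The one below is generated by the coordinates,
   as for n.-tuple in the library: it is the Borel sigma-algebra. *)
Definition rV_display : measure_display.
Proof. exact: default_measure_display. Qed.

Definition rV_coord (R : realType) (n : nat) (i : 'I_n) (x : 'rV[R]_n) : R :=
  x 0 i.

Section measurable_rV.
Context {R : realType} (n : nat).

Let rV_set0 : g_sigma_preimage (@rV_coord R n) set0.
Proof. exact: sigma_algebra0. Qed.

Let rV_setC A : g_sigma_preimage (@rV_coord R n) A ->
  g_sigma_preimage (@rV_coord R n) (~` A).
Proof. exact: sigma_algebraC. Qed.

Let rV_bigcup (F : _^nat) : (forall i, g_sigma_preimage (@rV_coord R n) (F i)) ->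
  g_sigma_preimage (@rV_coord R n) (\bigcup_i (F i)).
Proof. exact: sigma_algebra_bigcup. Qed.

HB.instance Definition _ := @isMeasurable.Build rV_display 'rV[R]_n
  (g_sigma_preimage (@rV_coord R n)) rV_set0 rV_setC rV_bigcup.

End measurable_rV.

Lemma measurable_rV_coord (R : realType) n (i : 'I_n) :
  measurable_fun [set: 'rV[R]_n] (rV_coord i).
Proof.
move=> _ Y mY; rewrite setTI; apply: sub_sigma_algebra => /=.
rewrite -bigcup_seq/=; exists i => /=; first by rewrite mem_index_enum.
by exists Y => //; rewrite setTI.
Qed.

Lemma measurable_fun_rV_coordP d (T : measurableType d) (R : realType) n
    (f : T -> 'rV[R]_n) :
  (forall i, measurable_fun [set: T] (rV_coord i \o f)) ->
  measurable_fun [set: T] f.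
Proof.
move=> mf; suff prefS : g_sigma_preimage (fun i => rV_coord i \o f) `<=` measurable.
  move=> _ A mA; apply: prefS.
  by rewrite (g_sigma_preimage_comp (@rV_coord R n) f); exists A.
apply: smallest_sub; first exact: sigma_algebra_measurable.
case: n => [|n] in f mf *; first by rewrite big_ord0.
rewrite -bigcup_mkord_ord; apply: bigcup_sub => i Ii.
by move=> A [B mB <-]; exact: mf.
Qed.

(* the identifications of R * R^n with R^n.+1 *)
Definition rV_cons (R : realType) (n : nat) (p : R * 'rV[R]_n) : 'rV[R]_n.+1 :=
  \row_(j < n.+1) if unlift ord0 j is Some i then p.2 0 i else p.1.

Definition rV_uncons (R : realType) (n : nat) (x : 'rV[R]_n.+1) : R * 'rV[R]_n :=
  (x 0 ord0, \row_(i < n) x 0 (lift ord0 i)).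

Lemma rV_consK (R : realType) n : cancel (@rV_cons R n) (@rV_uncons R n).
Proof.
move=> [t y]; congr pair; first by rewrite mxE unlift_none.
by apply/rowP => i; rewrite !mxE liftK.
Qed.

Lemma rV_unconsK (R : realType) n : cancel (@rV_uncons R n) (@rV_cons R n).
Proof.
by move=> x; apply/rowP => j; rewrite mxE; case: unliftP => [i ->|->]; rewrite ?mxE.
Qed.

Lemma measurable_rV_cons (R : realType) n :
  measurable_fun [set: measurableTypeR R * 'rV[R]_n] (@rV_cons R n).
Proof.
apply: measurable_fun_rV_coordP => i; case: (unliftP ord0 i) => [j ->|->].
- rewrite [X in measurable_fun _ X](_ : _ = rV_coord j \o snd); last first.
    by apply/funext => p; rewrite /rV_coord /= mxE liftK.
  by apply: measurableT_comp; [exact: measurable_rV_coord|exact: measurable_snd].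
- rewrite [X in measurable_fun _ X](_ : _ = fst); last first.
    by apply/funext => p; rewrite /rV_coord /= mxE unlift_none.
  exact: measurable_fst.
Qed.

Lemma measurable_rV_uncons (R : realType) n :
  measurable_fun setT (@rV_uncons R n : _ -> measurableTypeR R * 'rV[R]_n).
Proof.
apply: measurable_fun_pair; first exact: (measurable_rV_coord (n := n.+1) ord0).
apply: measurable_fun_rV_coordP => i.
rewrite [X in measurable_fun _ X](_ : _ = rV_coord (lift ord0 i)).
  exact: measurable_rV_coord.
by apply/funext => x; rewrite /rV_coord /= mxE.
Qed.

Section leb_cons.
Context (R : realType) (n : nat).
Variable m : {sigma_finite_measure set 'rV[R]_n -> \bar R}.

Definition leb_cons : set 'rV[R]_n.+1 -> \bar R :=
  pushforward (@lebesgue_measure R \x m)%E (@rV_cons R n).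

Let mpre A : measurable A ->
  measurable (@rV_cons R n @^-1` A : set (measurableTypeR R * 'rV[R]_n)).
Proof. by move=> mA; rewrite -[X in measurable X]setTI; exact: measurable_rV_cons. Qed.

Let leb_cons0 : leb_cons set0 = 0%E.
Proof. by rewrite /leb_cons /pushforward preimage_set0 measure0. Qed.

Let leb_cons_ge0 A : (0 <= leb_cons A)%E.
Proof. by rewrite /leb_cons /pushforward; apply: measure_ge0. Qed.

Let leb_cons_sigma_additive : semi_sigma_additive leb_cons.
Proof.
move=> F mF tF mUF; rewrite /leb_cons /pushforward preimage_bigcup.
apply: measure_semi_sigma_additive.
- by move=> k; exact: mpre.
- apply/trivIsetP => i j _ _ ij; rewrite -preimage_setI.
  by move/trivIsetP : tF => /(_ _ _ _ _ ij) ->//; rewrite preimage_set0.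
- by rewrite -preimage_bigcup; exact: mpre.
Qed.

HB.instance Definition _ := isMeasure.Build _ _ _ leb_cons
  leb_cons0 leb_cons_ge0 leb_cons_sigma_additive.

Let leb_cons_sigma_finite : sigma_finite setT leb_cons.
Proof.
have /sigma_finiteP[F [FT ndF Foo]] := sigma_finiteT (@lebesgue_measure R).
have /sigma_finiteP[G [GT ndG Goo]] := sigma_finiteT m.
exists (fun k => @rV_uncons R n @^-1` (F k `*` G k)).
  rewrite -preimage_bigcup (_ : \bigcup_k _ = setT) ?preimage_setT//.
  apply/seteqP; split => // -[x y] _.
  have [[i _ Fix] [j _ Gjy]] : (\bigcup_k F k) x /\ (\bigcup_k G k) y.
    by rewrite -FT -GT.
  exists (maxn i j) => //; split.
  - by move: x Fix; exact/subsetPset/ndF/leq_maxl.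
  - by move: y Gjy; exact/subsetPset/ndG/leq_maxr.
move=> k; have [mF Fk] := Foo k; have [mG Gk] := Goo k; split.
  rewrite -[X in measurable X]setTI.
  by apply: measurable_rV_uncons => //; exact: measurableX.
rewrite /leb_cons /pushforward -comp_preimage (_ : _ \o _ = id); last first.
  by apply/funext => p; exact: rV_consK.
by rewrite preimage_id product_measure1E// lte_mul_pinfty// ge0_fin_numE.
Qed.

HB.instance Definition _ := Measure_isSigmaFinite.Build _ _ _ leb_cons
  leb_cons_sigma_finite.

End leb_cons.

(* Lebesgue measure on R^n, as the n-fold product of lebesgue_measure *)
Fixpoint lebesgue_rV (R : realType) (n : nat) :
    {sigma_finite_measure set 'rV[R]_n -> \bar R} :=
  match n with
  | 0 => \d_(0 : 'rV[R]_0)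
  | n'.+1 => leb_cons (lebesgue_rV R n')
  end.

Lemma lebesgue_rV_box (R : realType) n (a b : 'rV[R]_n) :
  (forall i, a 0 i <= b 0 i) ->
  lebesgue_rV R n [set x | forall i, a 0 i < x 0 i < b 0 i] =
  (\prod_(i < n) (b 0 i - a 0 i))%:E.
Proof.
elim: n a b => [|n IHn] a b ab.
  by rewrite big_ord0 /= diracE mem_set// => -[].
rewrite big_ord_recl.
pose a' : 'rV[R]_n := \row_i a 0 (lift ord0 i).
pose b' : 'rV[R]_n := \row_i b 0 (lift ord0 i).
transitivity ((@lebesgue_measure R \x lebesgue_rV R n)%E
    (`]a 0 ord0, b 0 ord0[%classic `*`
    [set x : 'rV[R]_n | forall i, a' 0 i < x 0 i < b' 0 i])).
  congr ((_ \x _)%E _).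
  apply/seteqP; split=> [[t y] /= H|[t y] /= [+ H] i].
  - split.
      by have := H ord0; rewrite !mxE unlift_none in_itv.
    by move=> i; have := H (lift ord0 i); rewrite !mxE liftK.
  - rewrite in_itv/= => tab; rewrite mxE.
    case: unliftP => [j ->|->//].
    by have := H j; rewrite !mxE.
rewrite product_measure1E//; last first.
- rewrite (_ : [set x | _] = \bigcap_(i : 'I_n)
      (@rV_coord R n i @^-1` `]a' 0 i, b' 0 i[%classic)); last first.
    by apply/seteqP; split => [x H i _|x H i]; have := H i; rewrite /= in_itv//=; exact.
  apply: fin_bigcap_measurable => [|i _]; first exact: finite_finset.
  by rewrite -[X in measurable X]setTI; exact: measurable_rV_coord.
- rewrite /= lebesgue_measure_itv/= lte_fin IHn; last by move=> i; rewrite !mxE.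
  rewrite EFinM -EFinB; congr (_ * _)%E; last first.
    by congr EFin; apply: eq_bigr => i _; rewrite !mxE.
  case: ltP => // ba; have -> : a 0 ord0 = b 0 ord0 by apply/le_anti; rewrite ab.
  by rewrite subrr.
Qed.

Section sobolev_maximal.
Context {R : realType} {n : nat}.
Implicit Types (x c v : 'rV[R]_n) (A Q : set 'rV[R]_n) (f u : 'rV[R]_n -> R).
Local Notation mu := (lebesgue_rV R n).

Definition enorm v : R := Num.sqrt (\sum_(i < n) v 0 i ^+ 2).

Definition eball x (d : R) : set 'rV[R]_n := [set y | enorm (y - x) < d].

Definition cube c (r : R) : set 'rV[R]_n :=
  [set y | forall i, c 0 i - r < y 0 i < c 0 i + r].

Definition cube_avg f Q : \bar R :=
  ((mu Q)^-1 * \int[mu]_(y in Q) `|f y|%:E)%E.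

Definition HL_noncentred f x : \bar R :=
  ereal_sup [set cube_avg f (cube p.1 p.2) |
             p in [set p : 'rV[R]_n * R | 0 < p.2 /\ cube p.1 p.2 x]].

Definition HL_centred f x : \bar R :=
  ereal_sup [set cube_avg f (cube x r) | r in [set r : R | 0 < r]].

(* the operator M; centred : bool selects which of the two is meant *)
Definition HL (centred : bool) f x : \bar R :=
  if centred then HL_centred f x else HL_noncentred f x.

Definition partial (i : 'I_n) f : 'rV[R]_n -> R := 'D_(delta_mx 0 i) f.

Definition iter_partial (s : seq 'I_n) f : 'rV[R]_n -> R := foldr partial f s.

(* C^infty : all iterated partial derivatives exist and are continuous *)
Definition smooth f : Prop := forall s : seq 'I_n,
  continuous (iter_partial s f) /\
  forall x i, derivable (iter_partial s f) x (delta_mx 0 i).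

Definition supp f : set 'rV[R]_n := closure [set x | f x != 0].

Definition test_function f : Prop := smooth f /\ compact (supp f).

(* v represents the distributional i-th partial derivative of w when acting on
   test functions with support not meeting A. The values of the integral of
   the library are meaningful for integrable functions only. *)
Definition weak_partial_off A (i : 'I_n) (w : 'rV[R]_n -> \bar R)
    (v : 'rV[R]_n -> R) : Prop :=
  forall phi, test_function phi -> supp phi `&` A = set0 ->
  [/\ mu.-integrable setT (fun x => w x * (partial i phi x)%:E)%E,
      mu.-integrable setT (fun x => (v x * phi x)%:E) &
      (- (\int[mu]_x (w x * (partial i phi x)%:E)) =
       \int[mu]_x (v x * phi x)%:E)%E].

(* u is in W^{1,1}(R^n) and has weak gradient Du *)
Definition W11_gradient u (Du : 'rV[R]_n -> 'rV[R]_n) : Prop :=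
  mu.-integrable setT (EFin \o u) /\
  forall i, mu.-integrable setT (fun x => (Du x 0 i)%:E) /\
            weak_partial_off set0 i (EFin \o u) (fun x => Du x 0 i).

Definition weak_L1 f : Prop :=
  measurable_fun setT f /\
  (ereal_sup [set (l%:E * mu [set x | (l < `|f x|)%R])%E |
              l in [set l : R | (0 < l)%R]] < +oo)%E.

End sobolev_maximal.

(* Main.v *)
(* Since M is a supremum of averages, which commute with translations, the
   inequality |u (x + t e) - u x| <= int_0^t |Du| (x + s e) ds, valid almost
   everywhere by testing against the fundamental lemma, gives
   Mu (x + t e) <= Mu x + int_0^t M|Du| (x + s e) ds for ALL x, and
   symmetrically: M|Du| is an upper gradient of Mu along coordinate lines.
   Near a point outside A the function M|Du| is integrable. There Mu is
   integrable as well (by slicing) and it is absolutely continuous along almost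
   all lines, with derivative h bounded by M|Du|, so that h represents the
   distributional derivative and C = 1. The weak type (1,1) estimate for M puts
   h in weak L^1. *)
From HB Require Import structures.
Require Import Defs.
From mathcomp Require Import all_boot all_order all_algebra.
From mathcomp Require Import all_classical all_reals all_analysis.
From mathcomp Require Import measurable_realfun ring lra.

Set Implicit Arguments.
Unset Strict Implicit.
Unset Printing Implicit Defensive.
Import Order.TTheory GRing.Theory Num.Theory.
Import numFieldNormedType.Exports.
Local Open Scope classical_set_scope.
Local Open Scope ring_scope.

(** * Boxes and cubes in R^n *)

Section boxes.
Context {R : realType} {n : nat}.
Implicit Types (a b x y z : 'rV[R]_n).
Local Notation mu := (lebesgue_rV R n).

(** A function in weak $L^1$ such as $M|\nabla u|$ need not be locally integrable, and $Mu$ may be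
    infinite on a null set; inequalities are therefore additive in $[0,+\infty]$ until finiteness is
    known. Since $\operatorname{supp}\varphi$ is compact and avoids $A$, finitely many cubes on
    which $M|\nabla u|$ has finite integral cover it together with its small translates, and $Mu$
    and $h$ are truncated to their union. No integration by parts takes place on individual lines.
    The link between lines and weak derivatives is the correlation $s \mapsto \int w(x)\varphi(x - s
    e)\,dx$: it is differentiable because $\varphi$ is, and Fubini expresses its increments through
    integrals along lines. For $u$ this leads from the weak derivative to the lines, for $Mu$ from
    the lines back to the weak derivative. The function $h$ is defined on all of $\mathbb{R}^n$ at
    once, from difference quotients at steps $1/(k+1)$, so its measurability does not depend on
    choices made line by line. *)

Definition box a b : set 'rV[R]_n := [set x | forall i, a 0 i < x 0 i < b 0 i].

Lemma measurable_box a b : measurable (box a b).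
Proof.
rewrite (_ : box a b = \bigcap_(i : 'I_n)
    (@rV_coord R n i @^-1` `]a 0 i, b 0 i[%classic)); last first.
  by apply/seteqP; split => [x H i _|x H i]; have := H i; rewrite /= in_itv//=; exact.
apply: fin_bigcap_measurable => [|i _]; first exact: finite_finset.
by rewrite -[X in measurable X]setTI; exact: measurable_rV_coord.
Qed.

Lemma rV_coord_bounded (x : 'rV[R]_n) :
  exists k : nat, forall i, `|x 0 i| < k%:R.
Proof.
exists (Num.bound (\sum_i `|x 0 i|)) => i.
apply: le_lt_trans (archi_boundP _); last by rewrite sumr_ge0.
by rewrite (bigD1 i)//= lerDl sumr_ge0.
Qed.

Lemma bigcup_box : \bigcup_k box (const_mx (- k%:R)) (const_mx k%:R) = setT.
Proof.
rewrite -subTset => x _; have [k xk] := rV_coord_bounded x.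
by exists k => // i; rewrite !mxE -ltr_norml.
Qed.

(** With [boxI] this makes the boxes a generating pi-system, so that measures are compared on boxes
    only. A half-space in direction [i] is a countable union of boxes whose other sides grow. *)
Lemma measurable_rVE : @measurable _ 'rV[R]_n = <<s range (fun p => box p.1 p.2) >>.
Proof.
apply/seteqP; split; last first.
  apply: smallest_sub; first exact: sigma_algebra_measurable.
  by move=> _ [[a b] _ <-]; exact: measurable_box.
pose G := range (fun p : 'rV[R]_n * 'rV[R]_n => box p.1 p.2).
suff mid : measurable_fun setT (id : g_sigma_algebraType G -> 'rV[R]_n).
  by move=> A mA; have := mid measurableT A mA; rewrite setTI.
apply: measurable_fun_rV_coordP => i.
apply: (measurability _ (RGenOInfty.measurableE R)).
move=> _ [_ [t ->] <-]; rewrite setTI.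
rewrite (_ : _ @^-1` _ =
    \bigcup_k box (\row_j if j == i then t else - k%:R) (const_mx k%:R)).
  apply: bigcup_measurable => k _; apply: sub_sigma_algebra.
  by exists (\row_j (if j == i then t else - k%:R), const_mx k%:R).
apply/seteqP; split => [x/=|x [k _ xk]].
  rewrite in_itv/= andbT => tx; have [k xk] := rV_coord_bounded x.
  exists k => // j; rewrite !mxE; have := xk j; rewrite ltr_norml => /andP[xj ->].
  by case: eqP => [->|_]; rewrite ?tx ?xj.
by have := xk i; rewrite !mxE eqxx /= in_itv/= andbT => /andP[].
Qed.

Lemma boxI a b a' b' : box a b `&` box a' b' =
  box (\row_i Num.max (a 0 i) (a' 0 i)) (\row_i Num.min (b 0 i) (b' 0 i)).
Proof.
apply/seteqP; split => [x [H H'] i|x H]; last first.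
  split => i; have := H i; rewrite !mxE gt_max lt_min.
    by move=> /andP[/andP[-> _] /andP[-> _]].
  by move=> /andP[/andP[_ ->] /andP[_ ->]].
have := H i; have := H' i; rewrite !mxE gt_max lt_min.
by move=> /andP[-> ->] /andP[-> ->].
Qed.

(** Truncation at 0 covers the empty boxes, which arise as intersections: an inverted side
    contributes a zero factor. *)
Lemma measure_box a b : mu (box a b) = (\prod_i Num.max (b 0 i - a 0 i) 0)%:E.
Proof.
have [ab|] := pselect (forall i, a 0 i <= b 0 i).
  rewrite [LHS](lebesgue_rV_box ab); congr EFin; apply: eq_bigr => i _.
  by apply/esym/max_idPl; rewrite subr_ge0.
move/existsNP => [i /negP]; rewrite -ltNge => ba.
rewrite (bigD1 i)//= (max_idPr _) ?subr_le0 1?ltW// mul0r.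
rewrite (_ : box a b = set0) ?measure0// -subset0 => x /(_ i).
by move=> /andP[ax xb]; have := lt_trans ax xb; rewrite ltNge (ltW ba).
Qed.

Lemma measure_box_lty a b : (mu (box a b) < +oo)%E.
Proof. by rewrite measure_box ltry. Qed.

Lemma rV_measure_unique (m1 m2 : {measure set 'rV[R]_n -> \bar R}) :
  (forall a b, (m1 (box a b) < +oo)%E) ->
  (forall a b, m1 (box a b) = m2 (box a b)) ->
  forall A, measurable A -> m1 A = m2 A.
Proof.
move=> m1oo m12; apply: (measure_unique (range (fun p => box p.1 p.2))
  (fun k => box (const_mx (- k%:R)) (const_mx k%:R))).
- exact: measurable_rVE.
- by move=> _ _ [p _ <-] [q _ <-]; rewrite boxI; eexists (_, _).
- by move=> k; eexists (_, _).
- exact: bigcup_box.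
- by move=> _ [p _ <-]; exact: m12.
- by move=> k; exact: m1oo.
Qed.

Lemma measurable_rV_add d (T : measurableType d) (f g : T -> 'rV[R]_n) :
  measurable_fun setT f -> measurable_fun setT g ->
  measurable_fun setT (fun t => f t + g t).
Proof.
move=> mf mg; apply: measurable_fun_rV_coordP => i.
rewrite (_ : _ \o _ = (fun t => rV_coord i (f t) + rV_coord i (g t))); last first.
  by apply/funext => t; rewrite /rV_coord /= mxE.
by apply: measurable_funD; apply: measurableT_comp => //; exact: measurable_rV_coord.
Qed.

Lemma measurable_rV_scale d (T : measurableType d) (f : T -> R) (e : 'rV[R]_n) :
  measurable_fun setT f -> measurable_fun setT (fun t => f t *: e).
Proof.
move=> mf; apply: measurable_fun_rV_coordP => i.
rewrite (_ : _ \o _ = (fun t => f t * e 0 i)); last first.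
  by apply/funext => t; rewrite /rV_coord /= mxE.
by apply: measurable_funM => //; exact: measurable_cst.
Qed.

Lemma measurable_shift z : measurable_fun setT (fun x => x + z).
Proof. by apply: measurable_rV_add => //; exact: measurable_cst. Qed.

Lemma lebesgue_rV_shift z A : measurable A -> mu ((fun x => x + z) @^-1` A) = mu A.
Proof.
move=> mA; apply/esym.
pose m2 := measure_function_pushforward__canonical__measure_function_Measure
  mu (measurable_shift z).
apply: (@rV_measure_unique mu m2) => // a b; first exact: measure_box_lty.
have shiftE : (fun x => x + z) @^-1` box a b = box (a - z) (b - z).
  by apply/seteqP; split => x H i; have := H i; rewrite !mxE ltrBlDr ltrBrDr.
transitivity (mu (box (a - z) (b - z))); last by rewrite -shiftE.
rewrite measure_box [LHS]measure_box; congr EFin; apply: eq_bigr => i _.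
by rewrite !mxE; congr Num.max; ring.
Qed.

Lemma ge0_integral_shift z (f : 'rV[R]_n -> \bar R) : measurable_fun setT f ->
  (forall x, (0 <= f x)%E) ->
  (\int[mu]_x f (x + z)%R = \int[mu]_x f x)%E.
Proof.
move=> mf f0; rewrite -[RHS](@eq_measure_integral _ _ _ _ mu
    (measure_function_pushforward__canonical__measure_function_Measure
      mu (measurable_shift z))); last first.
  by move=> A mA _; exact: lebesgue_rV_shift.
by rewrite [RHS]ge0_integral_pushforward//; exact: measurable_shift.
Qed.

Lemma integrable_shift z (f : 'rV[R]_n -> \bar R) :
  mu.-integrable setT f -> mu.-integrable setT (fun x => f (x + z)).
Proof.
move=> /integrableP[mf foo]; apply/integrableP; split.
  by apply: (measurableT_comp mf); exact: measurable_shift.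
rewrite (@ge0_integral_shift z (fun x => `|f x|%E))//.
exact: measurableT_comp.
Qed.

Lemma integral_shift z (f : 'rV[R]_n -> \bar R) : measurable_fun setT f ->
  (\int[mu]_x f (x + z)%R = \int[mu]_x f x)%E.
Proof.
move=> mf; rewrite [LHS]integralE [RHS]integralE; congr (_ - _)%E.
  rewrite -(ge0_integral_shift z (measurable_funepos mf))//.
  by apply: eq_integral => x _; rewrite !funeposE.
rewrite -(ge0_integral_shift z (measurable_funeneg mf))//.
by apply: eq_integral => x _; rewrite !funenegE.
Qed.

Lemma ge0_integral_shift_set z (f : 'rV[R]_n -> \bar R) A : measurable A ->
  measurable_fun setT f -> (forall x, (0 <= f x)%E) ->
  (\int[mu]_(x in (fun x => x + z)%R @^-1` A) f (x + z)%R = \int[mu]_(x in A) f x)%E.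
Proof.
move=> mA mf f0; rewrite integral_mkcond [RHS]integral_mkcond.
rewrite -[RHS](ge0_integral_shift z); last 2 first.
- by apply/(measurable_restrictT _ _).1 => //; exact: measurable_funS mf.
- by move=> x; rewrite patchE; case: ifP.
by apply: eq_integral => x _; rewrite !patchE.
Qed.

End boxes.

(** * Cubes as a base of the topology, and measurability of open sets *)

Section cubes.
Context {R : realType} {n : nat}.
Implicit Types (c x z : 'rV[R]_n).
Local Notation mu := (lebesgue_rV R n).

Lemma cubeE c r : cube c r = box (c - const_mx r) (c + const_mx r).
Proof. by apply/seteqP; split => x H i; have := H i; rewrite !mxE. Qed.

Lemma measurable_cube c r : measurable (cube c r).
Proof. by rewrite cubeE; exact: measurable_box. Qed.

Lemma measure_cube c r : 0 <= r -> mu (cube c r) = ((2 * r) ^+ n)%:E.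
Proof.
move=> r0; rewrite cubeE measure_box; congr EFin.
rewrite -[in RHS](card_ord n) -prodr_const; apply: eq_bigr => i _.
by rewrite !mxE (max_idPl _); lra.
Qed.

Lemma cube_shift z c r : (fun x => x + z) @^-1` cube (c + z) r = cube c r.
Proof.
by apply/seteqP; split => x H i; have := H i; rewrite !mxE; lra.
Qed.

Lemma cube_center c r : 0 < r -> cube c r c.
Proof. by move=> r0 i; rewrite ltrBlDr !ltrDl r0. Qed.

Lemma cube_sub c c' r r' :
  (forall i, `|c 0 i - c' 0 i| + r <= r') -> cube c r `<=` cube c' r'.
Proof.
move=> H x xc i; have := H i; have /andP[] := xc i => ? ? Hi.
have := ler_norm (c 0 i - c' 0 i); have := ler_norm (- (c 0 i - c' 0 i)).
by rewrite normrN => ? ?; apply/andP; split; lra.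
Qed.

Lemma nbhs_cube c r : 0 < r -> nbhs c (cube c r).
Proof.
move=> r0; apply/nbhs_ballP; exists r => //= y [_ cy] i.
by have := cy 0 i; rewrite /ball/= ltr_distlC.
Qed.

Lemma cube_sub_ball c r : 0 < r -> cube c r `<=` ball c r.
Proof.
move=> r0 y yc; split => // i j; have := yc j; rewrite (ord1 i).
by rewrite /ball/= ltr_distlC.
Qed.

Lemma open_cubeP (U : set 'rV[R]_n) :
  (forall x, U x -> exists2 r, 0 < r & cube x r `<=` U) -> open U.
Proof.
move=> H; rewrite openE => x /H[r r0 rU].
by apply: filterS (nbhs_cube _ r0).
Qed.

Lemma open_cube_sub (U : set 'rV[R]_n) x : open U -> U x ->
  exists2 r, 0 < r & cube x r `<=` U.
Proof.
move=> oU Ux; have : nbhs x U by exact: open_nbhs_nbhs.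
move=> /nbhs_ballP[r /= r0 rU]; exists r => //.
by apply: subset_trans rU; exact: cube_sub_ball.
Qed.

Lemma open_cube c r : open (cube c r).
Proof.
apply: open_cubeP => x xc.
pose e := \big[Num.min/1]_i Num.min (x 0 i - (c 0 i - r)) (c 0 i + r - x 0 i).
have e0 : 0 < e.
  apply: (big_ind (fun t => 0 < t)) => //; first by move=> u v u0 v0; rewrite lt_min u0.
  by move=> i _; have := xc i; rewrite lt_min; lra.
exists e => // y yx i.
have ei : e <= Num.min (x 0 i - (c 0 i - r)) (c 0 i + r - x 0 i).
  by rewrite /e (bigD1 i)//= ge_min lexx.
by move: ei; rewrite le_min; have := yx i; lra.
Qed.

Definition rat_cube (q : 'rV[rat]_n * rat) : set 'rV[R]_n :=
  cube (map_mx ratr q.1) (ratr q.2).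

Lemma rat_cube_basis (U : set 'rV[R]_n) x : open U -> U x ->
  exists2 q, rat_cube q x & rat_cube q `<=` U.
Proof.
move=> oU Ux; have [r r0 rU] := open_cube_sub oU Ux.
(* The rational centre will be within [s] of [x] in each coordinate, so the rational cube reaches at
   most [2 s < r] away from [x]. *)
have /rat_in_itvoo[s] : 0 < r / 2 by lra.
rewrite in_itv/= => /andP[s0 sr].
have /choice[c cP] : forall i : 'I_n, exists q : rat, `|x 0 i - ratr q| < ratr s.
  move=> i; have /rat_in_itvoo[q] : x 0 i - ratr s < x 0 i + ratr s.
    by move: s0; lra.
  by rewrite in_itv/= => qP; exists q; rewrite ltr_distlC.
exists (\row_i c i, s).
  by move=> i; rewrite !mxE -ltr_distlC distrC; exact: cP.
apply: subset_trans rU; apply: cube_sub => i; rewrite !mxE/=.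
by rewrite distrC; have := cP i; lra.
Qed.

(** Lindelöf property: every code [k] of a rational cube selects one member of the family containing
    that cube. The option type accounts for the codes without such a member, in particular when [D]
    is empty. *)
Lemma open_cover_countable (I : Type) (F : I -> set 'rV[R]_n) (D : set I) :
  (forall i, D i -> open (F i)) ->
  exists f : nat -> option I, (forall k i, f k = Some i -> D i) /\
    \bigcup_(i in D) F i = \bigcup_k (oapp F set0 (f k)).
Proof.
move=> oF.
pose P k i := D i /\ if unpickle k is Some q then rat_cube q `<=` F i else False.
have /choice[f fP] : forall k, exists o : option I,
    if o is Some i then P k i else forall i, ~ P k i.
  move=> k; have [[i Pi]|nP] := pselect (exists i, P k i); first by exists (Some i).
  by exists None => i Pi; apply: nP; exists i.
exists f; split; first by move=> k i fk; have := fP k; rewrite fk => -[].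
apply/seteqP; split => [x [i Di Fix]|x [k _]].
  have [q qx qF] := rat_cube_basis (oF _ Di) Fix.
  exists (pickle q) => //; have := fP (pickle q); rewrite /P pickleK.
  by case: (f _) => [j [Dj /(_ _ qx)]//|/(_ i)]; case.
by case fk : (f k) => [i|//] Fix; exists i => //; have := fP k; rewrite fk => -[].
Qed.

Lemma open_measurable_rV (U : set 'rV[R]_n) : open U -> measurable U.
Proof.
move=> oU.
pose D := [set p : 'rV[R]_n * R | cube p.1 p.2 `<=` U].
have [f [fD]] := @open_cover_countable _ (fun p => cube p.1 p.2) D
  (fun p _ => @open_cube p.1 p.2).
rewrite (_ : \bigcup_(i in D) _ = U) => [->|]; last first.
  apply/seteqP; split => [x [i Di]|x Ux]; first exact: Di.
  have [r r0 rU] := open_cube_sub oU Ux.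
  by exists (x, r) => //; exact: cube_center.
by apply: bigcup_measurable => k _; case: (f k) => //= p; exact: measurable_cube.
Qed.

Lemma continuous_measurable_rV (f : 'rV[R]_n -> R) : continuous f ->
  measurable_fun setT f.
Proof.
move=> cf; apply: (measurability _ (RGenOpens.measurableE R)).
move=> _ [_ [a [b ->]] <-]; rewrite setTI.
apply: open_measurable_rV; apply: open_comp; last exact: interval_open.
by move=> x _; exact: cf.
Qed.

Lemma lsc_measurable_rV (f : 'rV[R]_n -> \bar R) :
  (forall a : R, open [set x | (a%:E < f x)%E]) -> measurable_fun setT f.
Proof.
move=> H; apply: (measurability _ (ErealGenOInfty.measurableE R)).
move=> _ [_ [a ->] <-]; rewrite setTI.
rewrite (_ : _ @^-1` _ = [set x | (a%:E < f x)%E]); first exact: open_measurable_rV (H a).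
by apply/seteqP; split => x /=; rewrite in_itv/= andbT.
Qed.

End cubes.

(** * Functions with an upper gradient on the line *)

Lemma density_measure d (T : measurableType d) (R : realType)
    (mu : {measure set T -> \bar R}) (f : T -> \bar R) :
  measurable_fun setT f -> (forall x, (0 <= f x)%E) ->
  exists m : {measure set T -> \bar R}, forall A, (m A = \int[mu]_(x in A) f x)%E.
Proof.
move=> mf f0; pose m A := (\int[mu]_(x in A) f x)%E.
have m0 : m set0 = 0%E by rewrite /m integral_set0.
have m_ge0 A : (0 <= m A)%E by exact: integral_ge0.
have m_sa : semi_sigma_additive m.
  move=> F mF tF mUF; rewrite /m ge0_integral_bigcup//; last exact: measurable_funTS.
  by apply: is_cvg_ereal_nneg_natsum_cond => k _ _; exact: m_ge0.
pose mm : {measure set T -> \bar R} := HB.pack m (isMeasure.Build _ _ _ m m0 m_ge0 m_sa).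
by exists mm.
Qed.

Lemma stieltjes_measure (R : realType) (W : R -> R) :
  {homo W : s t / s <= t} -> right_continuous W ->
  exists nu : {measure set (measurableTypeR R) -> \bar R},
    (forall s t, s <= t -> nu `]s, t]%classic = (W t - W s)%:E) /\
    (forall m : {measure set (measurableTypeR R) -> \bar R},
      (forall s t, s <= t -> m `]s, t]%classic = (W t - W s)%:E) ->
      forall A, measurable A -> nu A = m A).
Proof.
move=> nW cW.
pose Wc : cumulative R R := HB.pack W (isCumulative.Build R _ R W nW cW).
have nuE s t : s <= t -> lebesgue_stieltjes_measure Wc `]s, t]%classic = (W t - W s)%:E.
  move=> st; rewrite /lebesgue_stieltjes_measure /measure_extension.
  rewrite measurable_mu_extE/=; last exact: is_ocitv.
  by rewrite wlength_itv_bnd// EFinB.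
exists (lebesgue_stieltjes_measure Wc); split => // m mE A mA.
apply: lebesgue_stieltjes_measure_unique => // _ [[s t] _ <-]/=.
have [st|ts] := leP s t; first by rewrite nuE// mE.
by rewrite set_itv_ge ?measure0// -leNgt bnd_simp ltW.
Qed.

Lemma finite_measure_pack d (T : measurableType d) (R : realType)
    (nu : {measure set T -> \bar R}) : fin_num_fun nu ->
  exists m : {finite_measure set T -> \bar R}, forall A, m A = nu A.
Proof.
move=> nufin; have nuT : (nu setT < +oo)%E by rewrite -ge0_fin_numE// nufin.
exists (mfrestr measurableT nuT) => A.
by transitivity (nu (A `&` setT)); last rewrite setIT.
Qed.

Section upper_gradient_line.
Context {R : realType}.
Local Notation leb := (@lebesgue_measure R).

Lemma Rintegral_itv_diff (f : R -> R) s t : leb.-integrable setT (EFin \o f) -> s <= t ->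
  (\int[leb]_(x in `]-oo, t]) f x - \int[leb]_(x in `]-oo, s]) f x =
   \int[leb]_(x in `]s, t]) f x)%R.
Proof.
move=> intf st; apply: Rintegral_itvB; rewrite ?bnd_simp//.
by apply: integrableS intf => //.
Qed.

Lemma right_continuous_integral (f : R -> R) : leb.-integrable setT (EFin \o f) ->
  right_continuous (fun t => \int[leb]_(x in `]-oo, t]) f x)%R.
Proof.
move=> intf s; apply/cvgrPdist_lt => e e0.
have [d [d0 dP]] := integral_normr_continuous intf e0.
near=> t.
have st : s < t by near: t; exact: nbhs_right_gt.
have td : t < s + d by near: t; apply: nbhs_right_lt; rewrite ltrDl.
rewrite distrC Rintegral_itv_diff// ?ltW//.
apply: (le_lt_trans (le_normr_Rintegral _ _)) => //.
  by apply: integrableS intf.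
apply: dP => //; have := lebesgue_measure_itv `]s, t]; rewrite /= lte_fin st => ->.
by rewrite -EFinB lte_fin; lra.
Unshelve. all: by end_near. Qed.

(** A sequence of steps suffices here, and it is what keeps limits of difference quotients
    measurable later on. *)
Lemma cvg_diff_quotient (F : R -> R) (x l : R) : derivable F x 1 -> derive1 F x = l ->
  k.+1%:R * (F (x + k.+1%:R^-1) - F x) @[k --> \oo] --> l.
Proof.
move=> dF <-; rewrite derive1E.
have /cvg_ex[l' Fl'] := dF.
have -> : 'D_1 F x = l' by apply/cvg_lim.
have := @cvg_comp _ _ _ (fun k : nat => k.+1%:R^-1 : R)
  (fun h => h^-1 *: ((F \o shift x) (h *: 1) - F x)) \oo (0^'%classic) _ _ Fl'.
rewrite /comp/= => H.
apply: cvg_trans (H _); last first.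
  move=> A [e /= e0 eA]; near=> k; apply: eA => /=.
    rewrite sub0r normrN ger0_norm//.
    by near: k; exact: near_infty_natSinv_lt (PosNum e0).
  by rewrite invr_eq0 pnatr_eq0.
apply: near_eq_cvg; near=> k.
by rewrite invrK /GRing.scale/= mulr1 (addrC x).
Unshelve. all: by end_near. Qed.

(* With G a primitive of gr, the functions G + V and G - V are nondecreasing and
   their Stieltjes measures add up to 2 gr dx. The first one thus has a density,
   which is a pointwise derivative by Lebesgue differentiation. *)
Lemma upper_gradient_line_core (V gr : R -> R) :
  (forall x, 0 <= gr x) -> leb.-integrable setT (EFin \o gr) ->
  (forall s t, s <= t -> `|V t - V s| <= \int[leb]_(x in `]s, t]) gr x) ->
  exists p : R -> R, [/\ leb.-integrable setT (EFin \o p),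
    forall s t, s <= t -> V t - V s = (\int[leb]_(x in `]s, t]) p x)%R &
    {ae leb, forall x, `|p x| <= gr x /\
      k.+1%:R * (V (x + k.+1%:R^-1) - V x) @[k --> \oo] --> p x}].
Proof.
move=> gr0 igr VG.
pose G t := (\int[leb]_(x in `]-oo, t]) gr x)%R.
have GE s t : s <= t -> (\int[leb]_(x in `]s, t]) gr x)%R = G t - G s.
  by move=> st; rewrite /G Rintegral_itv_diff.
have {}VG s t : s <= t -> `|V t - V s| <= G t - G s by move=> st; rewrite -GE// VG.
have cG := right_continuous_integral igr.
have cV : right_continuous V.
  move=> s; apply/cvgrPdist_lt => e e0.
  have /cvgrPdist_lt/(_ e e0) Ge := cG s; near=> t.
  have st : s <= t by near: t; exact: nbhs_right_ge.
  rewrite distrC (le_lt_trans (VG _ _ st))//.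
  have : `|G s - G t| < e by near: t; exact: Ge.
  by apply: le_lt_trans; rewrite distrC; exact: ler_norm.
pose W1 t := G t + V t; pose W2 t := G t - V t.
have nW1 : {homo W1 : s t / s <= t}.
  move=> s t st; have := VG _ _ st; rewrite ler_norml /W1 => /andP[]; lra.
have nW2 : {homo W2 : s t / s <= t}.
  move=> s t st; have := VG _ _ st; rewrite ler_norml /W2 => /andP[]; lra.
have cW1 : right_continuous W1 by move=> s; apply: cvgD; [exact: cG|exact: cV].
have cW2 : right_continuous W2 by move=> s; apply: cvgB; [exact: cG|exact: cV].
(* [W3] is [W1 + W2]. Uniqueness of its Stieltjes measure is applied twice, to [2 gr dx] and to
   [nu1 + nu2], whence [nu1 <= 2 gr dx]: so [nu1] is finite and absolutely continuous. *)
pose W3 t := 2 * G t.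
have nW3 : {homo W3 : s t / s <= t}.
  by move=> s t st; have := nW1 _ _ st; have := nW2 _ _ st; rewrite /W1 /W2 /W3; lra.
have cW3 : right_continuous W3.
  by move=> s; apply: cvgMr; exact: cG.
have [nu1 [nu1E _]] := stieltjes_measure nW1 cW1.
have [nu2 [nu2E _]] := stieltjes_measure nW2 cW2.
have [nu3 [nu3E nu3U]] := stieltjes_measure nW3 cW3.
have mgr : measurable_fun setT gr by apply/measurable_EFinP; case/integrableP : igr.
have i2gr : leb.-integrable setT (EFin \o (fun x => 2 * gr x)).
  have := integrableZl measurableT 2 igr; apply: eq_integrable => //.
have [kap kapE] := @density_measure _ _ _ leb (EFin \o (fun x => 2 * gr x))
  (measurable_int _ i2gr) (fun x => ltac:(by rewrite lee_fin mulr_ge0)).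
have nu3kap A : measurable A -> nu3 A = kap A.
  move=> mA; apply: nu3U => // s t st.
  rewrite kapE /W3 -mulrBr -GE// -RintegralZl//; last exact: integrableS igr.
  rewrite /Rintegral fineK//; apply: integrable_fin_num => //.
  exact: integrableS i2gr.
have nu12 A : measurable A -> nu3 A = (nu1 A + nu2 A)%E.
  move=> mA; rewrite -measure_addE; apply: nu3U => // s t st.
  rewrite [LHS]measure_addE nu1E// nu2E// -EFinD /W1 /W2 /W3.
  by congr EFin; ring.
have nu1kap A : measurable A -> (nu1 A <= kap A)%E.
  by move=> mA; rewrite -nu3kap// nu12// leeDl.
have nu1fin : fin_num_fun (nu1 : set (measurableTypeR R) -> \bar R).
  move=> A mA; rewrite ge0_fin_numE//; apply: le_lt_trans (nu1kap _ mA) _.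
  rewrite kapE; apply: integrable_lty => //; exact: integrableS i2gr.
have [nu1f nu1fE] := finite_measure_pack nu1fin.
have nu1leb : nu1f `<< leb.
  apply/null_content_dominatesP => A mA A0; apply/eqP.
  rewrite -measure_le0; apply: (@le_trans _ _ (nu1 A)); first by rewrite -nu1fE.
  apply: le_trans (nu1kap _ mA) _.
  rewrite kapE null_set_integral//.
  by apply: measurable_funTS; exact: measurable_int i2gr.
have [f [f0 ffin fint fE]] := @radon_nikodym_sigma_finite _ _ _ leb nu1f nu1leb.
pose p1 (x : R) : R := fine (f x).
have fp1 : f = EFin \o p1 by apply/funext => x /=; rewrite /p1 fineK.
have ip1 : leb.-integrable setT (EFin \o p1) by rewrite -fp1.
have W1E s t : s <= t -> W1 t - W1 s = (\int[leb]_(x in `]s, t]) p1 x)%R.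
  move=> st; have := fE _ (measurable_itv `]s, t]).
  by rewrite [LHS]nu1fE nu1E// fp1 /Rintegral => <-.
have ip : leb.-integrable setT (EFin \o (fun x => p1 x - gr x)).
  by have := integrableB measurableT ip1 igr; apply: eq_integrable.
have loc (h : R -> R) : leb.-integrable setT (EFin \o h) ->
    {ae leb, forall x, derivable (fun t : R => \int[leb]_(x in `]-oo, t]) h x)%R x 1 /\
       derive1 (fun t : R => \int[leb]_(x in `]-oo, t]) h x)%R x = h x}.
  move=> ih; apply: FTC1Ny; first by move=> y; exact: integrableS ih.
  exact: (open_integrable_locally openT).
(* [V] is [W1 - G], so its density is that of [W1] minus [gr]. *)
exists (fun x : R => p1 x - gr x); split => //.
  move=> s t st; rewrite RintegralB//; [|exact: integrableS ip1|exact: integrableS igr].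
  by rewrite GE// -W1E// /W1; ring.
have aep1 := loc _ ip1; have aegr := loc _ igr.
have aeF : Filter (almost_everywhere leb) := ae_filter_ringOfSetsType leb.
apply: filterS2 aep1 aegr => x [dp1 p1E] [dgr grE].
have cvgG := cvg_diff_quotient dgr grE.
have cvgV : k.+1%:R * (V (x + k.+1%:R^-1) - V x) @[k --> \oo] --> p1 x - gr x.
  have H := cvgB (cvg_diff_quotient dp1 p1E) cvgG.
  suff E : (fun k : nat => k.+1%:R * (V (x + k.+1%:R^-1) - V x)) =
      (fun k : nat => k.+1%:R *
        (\int[leb]_(t in `]-oo, (x + k.+1%:R^-1)%R]) p1 t -
         \int[leb]_(t in `]-oo, x]) p1 t)%R) - (fun k => k.+1%:R * (G (x + k.+1%:R^-1) - G x)).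
    by rewrite E; exact: H.
  apply/funext => k; rewrite !fctE/= -mulrBr; congr (_ * _).
  have xk : x <= x + k.+1%:R^-1 by rewrite lerDl.
  by rewrite Rintegral_itv_diff// -W1E// /W1; ring.
(* The difference quotients of [V] are dominated by those of [G], which tend to [gr x]. *)
split => //; apply: (ler_cvg_to (cvg_norm cvgV) cvgG); near=> k.
rewrite normrM ger0_norm// ler_wpM2l// VG// lerDl//.
Unshelve. all: by end_near. Qed.
End upper_gradient_line.

(* The limit of q when it exists and is bounded by c. The value is forced to
   satisfy the bound c everywhere, which makes the pointwise estimate on the
   weak derivative of the maximal function hold without exceptional set. *)
Definition lim_quot {R : realType} (q : nat -> R) (c : \bar R) : R :=
  let L := limn_esup (EFin \o q) in fine (if (`|L| <= c)%E then L else 0%E).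

Lemma lim_quot_le (R : realType) (q : nat -> R) (c : \bar R) : (0 <= c)%E ->
  (`|lim_quot q c|%:E <= c)%E.
Proof.
rewrite /lim_quot; case: ifPn => [Lc c0|_ c0]; last by rewrite normr0.
(* When [c] is infinite the test also accepts an infinite limit; [fine] then returns 0 and the bound
   still holds. *)
by move: Lc; case: (limn_esup _) => [r| |] //= _; rewrite normr0.
Qed.

Lemma lim_quotE (R : realType) (q : nat -> R) (c : \bar R) (l : R) :
  q @ \oo --> l -> (`|l|%:E <= c)%E -> lim_quot q c = l.
Proof.
move=> ql lc; have /cvg_limn_einf_sup[_] : (EFin \o q) @ \oo --> l%:E.
  by apply: cvg_EFin => //; exact: nearW.
by rewrite /lim_quot => ->; rewrite lc.
Qed.

Lemma measurable_lim_quot d (T : measurableType d) (R : realType)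
    (q : T -> nat -> R) (c : T -> \bar R) :
  (forall k, measurable_fun setT (q ^~ k)) -> measurable_fun setT c ->
  measurable_fun setT (fun x => lim_quot (q x) (c x)).
Proof.
move=> mq mc; apply: (measurableT_comp (@fine_measurable R setT measurableT)).
have mL : measurable_fun setT (fun x => limn_esup (EFin \o q x)).
  apply: (@measurable_fun_limn_esup _ T R setT (fun k x => (q x k)%:E)) => k.
  exact/measurable_EFinP.
apply: measurable_fun_ifT => //; apply: (measurable_fun_bool true).
by apply: measurable_lee => //; exact: measurableT_comp.
Qed.

Section upper_gradient_segment.
Context {R : realType}.
Local Notation leb := (@lebesgue_measure R).

(** Reduction to [upper_gradient_line_core], which asks for a real-valued gradient integrable on the
    whole line: [g] is made finite and cut to [[a, b]], and [V] is frozen outside the segment. *)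
Lemma upper_gradient_segment (a b : R) (V : R -> R) (g : R -> \bar R) :
  measurable_fun setT V -> measurable_fun setT g -> (forall x, (0 <= g x)%E) ->
  a <= b -> (\int[leb]_(x in `[a, b]) g x < +oo)%E ->
  (forall s t, a <= s -> s <= t -> t <= b ->
    (`|V t - V s|%:E <= \int[leb]_(x in `]s, t]) g x)%E) ->
  forall s t, a <= s -> s <= t -> t <= b -> ((V t - V s)%:E =
    \int[leb]_(x in `]s, t])
      (lim_quot (fun k => k.+1%:R * (V (x + k.+1%:R^-1) - V x)) (g x))%:E)%E.
Proof.
move=> mV mg g0 ab goo VG s t As st tb.
have ig : leb.-integrable `[a, b] g.
  apply/integrableP; split; first exact: measurable_funTS.
  by under eq_integral do rewrite gee0_abs//.
pose gr := (fine \o g) \_ `[a, b].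
have gr0 x : 0 <= gr x by rewrite /gr patchE; case: ifPn => // _; exact: fine_ge0.
have mfg : measurable_fun setT (fine \o g).
  by apply: (measurableT_comp (@fine_measurable R setT measurableT)).
have mgr : measurable_fun setT gr.
  by apply/(measurable_restrictT _ _).1 => //; exact: measurable_funTS.
have gr_le x : ((gr x)%:E <= g x)%E.
  rewrite /gr patchE; case: ifPn => // _ /=.
  by have := g0 x; case: (g x) => //= r _; rewrite leey.
have aegr : {ae leb, forall x, `[a, b]%classic x -> g x = (gr x)%:E}.
  have aeF : Filter (almost_everywhere leb) := ae_filter_ringOfSetsType leb.
  apply: filterS (integrable_ae _ ig) => // x H xab.
  by rewrite /gr patchE mem_set//= fineK// H.
have igr : leb.-integrable setT (EFin \o gr).
  apply/integrableP; split; first exact/measurable_EFinP.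
  apply: le_lt_trans goo.
  under eq_integral => x _ do rewrite /= ger0_norm//.
  rewrite [leRHS]integral_mkcond; apply: ge0_le_integral => //.
  - by move=> x _; rewrite lee_fin.
  - exact/measurable_EFinP.
  - by apply/(measurable_restrictT _ _).1 => //; exact: measurable_funTS.
  - move=> x _; rewrite patchE; case: ifPn => [_|xab]; first exact: gr_le.
    by rewrite /gr patchE (negbTE xab).
(* Projection onto [[a, b]]: increments of [V \o cl] over any interval are increments of [V] over
   its part inside the segment. *)
pose cl x := Num.max a (Num.min x b).
have cla x : a <= cl x by rewrite /cl le_max lexx.
have clb x : cl x <= b by rewrite /cl ge_max ab ge_min lexx orbT.
have cl_id x : a <= x -> x <= b -> cl x = x.
  by move=> ax xb; rewrite /cl (min_idPl xb) (max_idPr ax).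
have cl_nd x y : x <= y -> cl x <= cl y.
  by move=> xy; rewrite /cl; rewrite ge_max !le_max lexx/= le_min !ge_min xy lexx !orbT.
have cl_sub x y : `]cl x, cl y] `<=` `]x, y].
  move=> z/=; rewrite !in_itv/= /cl gt_max le_max le_min gt_min.
  move=> /andP[/andP[az xbz]] /orP[za|/andP[zy zb]]; first by move: az; rewrite ltNge za.
  by rewrite zy andbT; case/orP : xbz => //; rewrite ltNge zb.
pose V' x := V (cl x).
have V'G x y : x <= y -> `|V' y - V' x| <= (\int[leb]_(z in `]x, y]) gr z)%R.
  move=> xy; rewrite -lee_fin /Rintegral fineK; last first.
    by apply: integrable_fin_num => //; exact: integrableS igr.
  apply: (@le_trans _ _ (\int[leb]_(z in `]cl x, cl y]) g z)%E).
    by apply: VG => //; exact: cl_nd.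
  apply: (@le_trans _ _ (\int[leb]_(z in `]cl x, cl y]) (gr z)%:E)%E); last first.
    apply: ge0_subset_integral => //.
    - exact/measurable_EFinP/measurable_funTS.
    - by move=> z _; rewrite lee_fin.
  rewrite le_eqVlt; apply/orP; left; apply/eqP; apply: ge0_ae_eq_integral => //.
  - exact: measurable_funTS.
  - exact/measurable_EFinP/measurable_funTS.
  - by move=> z _; rewrite lee_fin.
  - have aeF : Filter (almost_everywhere leb) := ae_filter_ringOfSetsType leb.
    apply: filterS aegr => z H /=; rewrite in_itv/= => /andP[xz zy]; apply: H.
    by rewrite /= in_itv/= (le_trans (cla x) (ltW xz)) (le_trans zy).
have [p [ip VE pP]] := upper_gradient_line_core gr0 igr V'G.
have sb : s <= b by exact: le_trans tb.
have at' : a <= t by exact: le_trans st.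
transitivity (\int[leb]_(x in `]s, t]) (p x)%:E)%E.
  have := VE _ _ st; rewrite /V' !cl_id// => ->; rewrite /Rintegral fineK//.
  by apply: integrable_fin_num => //; exact: integrableS ip.
apply: ae_eq_integral => //.
- by apply: measurable_funTS; apply: measurable_int ip.
- apply/measurable_EFinP; apply: measurable_funTS.
  apply: measurable_lim_quot => // k; apply: measurable_funM => //.
  apply: measurable_funB => //; apply: (measurableT_comp mV).
  by apply: measurable_funD => //.
- have aeF : Filter (almost_everywhere leb) := ae_filter_ringOfSetsType leb.
  (* At [b] the quotients of [V] look beyond the segment, where [V] and [V'] may differ; at a point
     left of [b] they agree for large [k]. *)
  have aeb : {ae leb, forall x : R, x != b}.
    exists [set b]; split => //; first exact: lebesgue_measure_set1.
    by move=> x /= /negP; rewrite negbK => /eqP.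
  apply: filterS2 pP aeb => x [pgr pcvg] xb; rewrite /= in_itv/= => /andP[sx xt].
  congr EFin; apply/esym/lim_quotE; last first.
    by apply: le_trans (gr_le x); rewrite lee_fin.
  have xltb : x < b by rewrite lt_neqAle xb (le_trans xt).
  have bx : 0 < b - x by rewrite subr_gt0.
  apply: cvg_trans pcvg; apply: near_eq_cvg; near=> k.
  have ax : a <= x by rewrite (le_trans As)// ltW.
  have xk : k.+1%:R^-1 <= b - x.
    by apply: ltW; near: k; exact: (near_infty_natSinv_lt (PosNum bx)).
  rewrite /V' (cl_id x ax (ltW xltb)) cl_id//.
    by rewrite (le_trans ax)// lerDl.
  by rewrite addrC -lerBrDr.
Unshelve. all: by end_near. Qed.

End upper_gradient_segment.

(** * The maximal function and its weak type estimate *)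

Section maximal_function.
Context {R : realType} {n : nat}.
Implicit Types (f : 'rV[R]_n -> R) (x c : 'rV[R]_n) (p q : 'rV[R]_n * R).
Local Notation mu := (lebesgue_rV R n).

Lemma cube_avgE f c r : 0 < r -> cube_avg f (cube c r) =
  ((((2 * r) ^+ n)^-1)%:E * \int[mu]_(y in cube c r) `|f y|%:E)%E.
Proof.
move=> r0; rewrite /cube_avg measure_cube 1?ltW// inver.
by rewrite gt_eqF// exprn_gt0// mulr_gt0.
Qed.

Lemma cube_avg_ge0 f c r : 0 < r -> (0 <= cube_avg f (cube c r))%E.
Proof.
move=> r0; rewrite cube_avgE// mule_ge0//.
  by rewrite lee_fin invr_ge0 exprn_ge0// mulr_ge0// ltW.
by apply: integral_ge0 => y _; rewrite lee_fin.
Qed.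

Lemma HL_noncentred_ge f x c r : 0 < r -> cube c r x ->
  (cube_avg f (cube c r) <= HL_noncentred f x)%E.
Proof. by move=> r0 cx; apply: ereal_sup_ubound; exists (c, r). Qed.

Lemma HL_centred_ge f x r : 0 < r ->
  (cube_avg f (cube x r) <= HL_centred f x)%E.
Proof. by move=> r0; apply: ereal_sup_ubound; exists r. Qed.

Lemma HL_centred_le f x : (HL_centred f x <= HL_noncentred f x)%E.
Proof.
apply: ge_ereal_sup => _ [r/= r0 <-]; apply: HL_noncentred_ge => //.
exact: cube_center.
Qed.

Lemma HL_le_noncentred b f x : (HL b f x <= HL_noncentred f x)%E.
Proof. by case: b => //; exact: HL_centred_le. Qed.

Lemma HL_ge0 b f x : (0 <= HL b f x)%E.
Proof.
have H := cube_avg_ge0 f x ltr01; case: b; apply: (le_trans H).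
  exact: HL_centred_ge.
by apply: HL_noncentred_ge => //; exact: cube_center.
Qed.

Lemma open_HL_noncentred f (a : \bar R) : open [set x | (a < HL_noncentred f x)%E].
Proof.
apply: open_cubeP => x /= /ereal_sup_gt[_ [[c r]/= [r0 cx] <-] ax].
have [s s0 sc] := open_cube_sub (open_cube (c := c) (r := r)) cx.
by exists s => // y /sc yc /=; apply: (lt_le_trans ax); exact: HL_noncentred_ge.
Qed.

(** If the average over the cube of radius [r] about [x] exceeds [a], continuity from below gives a
    smaller radius [s k] for which the integral, still multiplied by the constant [c] of radius [r],
    exceeds [a]. The cube of radius [r] about any [y] close to [x] contains this smaller cube. *)
Lemma open_HL_centred f (a : \bar R) : measurable_fun setT f ->
  open [set x | (a < HL_centred f x)%E].
Proof.
move=> mf; apply: open_cubeP => x /= /ereal_sup_gt[_ [r/= r0 <-]].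
pose c := ((2 * r) ^+ n)^-1.
have c0 : 0 < c by rewrite invr_gt0 exprn_gt0// mulr_gt0.
rewrite cube_avgE// -/c => ax.
have [m mE] := @density_measure _ _ _ mu (fun y => `|f y|%:E)
  (ltac:(by apply/measurable_EFinP; exact: measurableT_comp))
  (fun y => ltac:(by rewrite lee_fin)).
pose s k : R := r - r / k.+2%:R.
have sr k : s k < r by rewrite /s ltrBlDr ltrDl divr_gt0.
have [k ak] : exists k, (a < c%:E * m (cube x (s k)))%E.
  apply/not_existsP => H.
  suff : (c%:E * m (cube x r) <= a)%E by rewrite leNgt mE ax.
  rewrite -lee_pdivlMl//.
  have -> : cube x r = \bigcup_k cube x (s k).
    apply/seteqP; split => [y yx|y [k _]]; last first.
      by apply: cube_sub => i; rewrite subrr normr0 add0r ltW.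
    have [e e0 ye] := open_cube_sub (open_cube (c := x) (r := r)) yx.
    pose d := \big[Num.max/0]_i `|y 0 i - x 0 i|.
    have dr : d < r.
      apply: (big_ind (fun t => t < r)) => //; first by move=> u v ur vr; rewrite gt_max ur.
      by move=> i _; have := yx i; rewrite -ltr_distlC distrC.
    have [k kP] : exists k : nat, r / k.+2%:R < r - d.
      have rd : 0 < r - d by rewrite subr_gt0.
      exists (Num.bound (r / (r - d))); rewrite ltr_pdivrMr// mulrC -ltr_pdivrMr//.
      apply: (lt_trans (archi_boundP _)); first by rewrite divr_ge0// ltW.
      by rewrite ltr_nat.
    exists k => // i; rewrite -ltr_distlC distrC.
    apply: (@le_lt_trans _ _ d); first by rewrite /d (bigD1 i)//= le_max lexx.
    by rewrite /s ltrBrDr addrC -ltrBrDr.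
  have mcvg := @nondecreasing_cvg_mu _ _ _ m (fun k => cube x (s k))
    (fun k => measurable_cube x (s k))
    (bigcup_measurable (fun k _ => measurable_cube x (s k))).
  apply: (cvge_to_le (mcvg _)).
    move=> i j ij; apply/subsetPset/cube_sub => l; rewrite subrr normr0 add0r.
    by rewrite /s lerD2l lerN2 ler_pM2l// lef_pV2// ?posrE// ler_nat.
  by apply: nearW => k; rewrite lee_pdivlMl//= leNgt; apply/negP => /H.
exists (r - s k); first by rewrite subr_gt0.
move=> y yx /=; apply: (@lt_le_trans _ _ (cube_avg f (cube y r))); last exact: HL_centred_ge.
rewrite cube_avgE// -/c; apply: (lt_le_trans ak).
rewrite lee_pmul2l// -mE le_measure ?inE//; [exact: measurable_cube|exact: measurable_cube|].
apply: cube_sub => i; have := yx i; rewrite -ltr_distlC.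
by move=> /ltW; lra.
Qed.

Lemma measurable_HL b f : measurable_fun setT f -> measurable_fun setT (HL b f).
Proof.
move=> mf; case: b; apply: lsc_measurable_rV => a.
  exact: open_HL_centred.
exact: open_HL_noncentred.
Qed.

(** Finite Vitali covering by greedy choice: a cube of largest radius is kept, those meeting it lie
    in its triple, and the selection goes on among those disjoint from it. *)
Lemma vitali_cubes (s : seq ('rV[R]_n * R)) : (forall p, p \in s -> 0 < p.2) ->
  exists D : seq ('rV[R]_n * R), [/\ {subset D <= s},
    pairwise (fun p q => `[< cube p.1 p.2 `&` cube q.1 q.2 = set0 >]) D &
    forall p, p \in s -> exists2 q, q \in D & cube p.1 p.2 `<=` cube q.1 (3 * q.2)].
Proof.
have [k] := ubnP (size s); elim: k s => // k IH s; rewrite ltnS => sk s0.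
have argmax (s' : seq ('rV[R]_n * R)) p0 :
    exists2 p, p \in p0 :: s' & forall q, q \in p0 :: s' -> q.2 <= p.2.
  elim: s' p0 => [|q s' IHs] p0.
    by exists p0; rewrite ?mem_head// => q; rewrite inE => /eqP ->.
  have [p] := IHs q; move=> ps pm; have [pp0|p0p] := leP p.2 p0.2.
    exists p0; rewrite ?mem_head// => q'; rewrite inE => /predU1P[->//|/pm].
    by move=> /le_trans; apply.
  exists p; first by rewrite inE ps orbT.
  by move=> q'; rewrite inE => /predU1P[->|/pm//]; exact: ltW.
case: s => [|p0 s'] in sk s0 *; first by exists [::].
have [p ps pmax] := argmax s' p0.
set s := p0 :: s' in sk s0 ps pmax *.
pose t := [seq q <- s | `[< cube p.1 p.2 `&` cube q.1 q.2 = set0 >]].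
(* The chosen cube is nonempty, hence removed from [t] along with the cubes that meet it, so the
   list gets strictly shorter. *)
have pt : ~~ `[< cube p.1 p.2 `&` cube p.1 p.2 = set0 >].
  apply/asboolPn; rewrite setIid => /seteqP[/(_ p.1)+ _]; apply.
  by apply: cube_center; exact: s0.
have tk : (size t < k)%N.
  apply: leq_trans sk; rewrite size_filter -(count_predC (fun q => `[< cube p.1 p.2 `&` cube q.1 q.2 = set0 >]) s).
  by rewrite -addn1 leq_add2l -has_count; apply/hasP; exists p.
have [D [Ds pD Dcov]] := IH t tk (fun q => ltac:(by rewrite mem_filter => /andP[_]; exact: s0)).
exists (p :: D); split.
- move=> q; rewrite inE => /predU1P[->//|/Ds]; by rewrite mem_filter => /andP[].
- rewrite /= pD andbT; apply/allP => q /Ds; by rewrite mem_filter => /andP[].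
- move=> q qs; have [qp|qp] := pselect (cube p.1 p.2 `&` cube q.1 q.2 = set0).
    have [|q' q'D qq'] := Dcov q; first by rewrite mem_filter qs andbT; apply/asboolP.
    by exists q' => //; rewrite inE q'D orbT.
  exists p; first exact: mem_head.
  (* Through the common point [z], a point of [q] is in each coordinate within
     [p.2 + 2 * q.2 <= 3 * p.2] of the centre of [p]. *)
  have /set0P[z [zp zq]] : cube p.1 p.2 `&` cube q.1 q.2 != set0 by apply/eqP.
  move=> x xq i; have := xq i; have := zp i; have := zq i; have := pmax _ qs.
  by move=> ? /andP[? ?] /andP[? ?] /andP[? ?]; apply/andP; split; lra.
Qed.

(** For one cube, [l |3Q| = 3^n l |Q|], which is at most [3^n] times the integral of [|f|] over [Q].
    Disjointness lets the integrals add up, while subadditivity is enough on the left. *)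
Lemma disjoint_cubes_bound f (l : R) (D : seq ('rV[R]_n * R)) :
  measurable_fun setT f -> 0 < l -> (forall p, p \in D -> 0 < p.2) ->
  pairwise (fun p q => `[< cube p.1 p.2 `&` cube q.1 q.2 = set0 >]) D ->
  (forall p, p \in D -> (l%:E < cube_avg f (cube p.1 p.2))%E) ->
  (l%:E * mu (\big[setU/set0]_(p <- D) cube p.1 (3 * p.2)%R) <=
   (3 ^+ n)%:E * \int[mu]_(y in \big[setU/set0]_(p <- D) cube p.1 p.2) `|f y|%:E)%E.
Proof.
move=> mf l0; elim: D => [_ _ _|p D IH D0 /=/andP[pD dD] DL].
  by rewrite !big_nil measure0 integral_set0 !mule0.
have mbig (r : R) : measurable (\big[setU/set0]_(q <- D) cube q.1 (r * q.2)%R).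
  by apply: bigsetU_measurable => q _; exact: measurable_cube.
have mbig1 : measurable (\big[setU/set0]_(q <- D) cube q.1 q.2).
  by apply: bigsetU_measurable => q _; exact: measurable_cube.
have disj : [disjoint cube p.1 p.2 & \big[setU/set0]_(q <- D) cube q.1 q.2].
  apply/disj_set2P; rewrite big_distrr/=; apply: big1_seq => q /andP[_ qD].
  by move/allP : pD => /(_ _ qD)/asboolP.
rewrite !big_cons (ge0_integral_setU mu (measurable_cube _ _) mbig1 _ _ disj)//; last first.
  by apply: measurable_funTS; apply/measurable_EFinP; exact: measurableT_comp.
have p0 : 0 < p.2 by apply: D0; exact: mem_head.
apply: (@le_trans _ _ (l%:E * (mu (cube p.1 (3 * p.2)%R) +
  mu (\big[setU/set0]_(q <- D) cube q.1 (3 * q.2)%R)))%E).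
  by rewrite lee_pmul2l//; exact: (measureU2 mu (measurable_cube _ _) (mbig _)).
rewrite muleDr//; last by rewrite ge0_adde_def// inE.
rewrite muleDr//; last by rewrite ge0_adde_def// inE integral_ge0// => y _; rewrite lee_fin.
apply: leeD; last first.
  apply: IH => // q qD; [apply: D0|apply: DL]; by rewrite inE qD orbT.
have := DL p (mem_head _ _); rewrite cube_avgE// => /ltW.
rewrite lee_pdivlMl ?exprn_gt0 ?mulr_gt0// => H.
rewrite measure_cube; last by rewrite mulr_ge0// ltW.
rewrite -EFinM mulrCA [X in (l * X)%:E]exprMn mulrCA EFinM.
by rewrite lee_pmul2l ?lte_fin ?exprn_gt0// mulrC EFinM.
Qed.

(** The level set is the union of the cubes with average above [l]. The Lindelöf property makes this
    union countable and continuity from below makes it finite, so that the finite Vitali lemma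
    applies. *)
Lemma maximal_weak_type f (l : R) : measurable_fun setT f -> 0 < l ->
  (l%:E * mu [set x | (l%:E < HL_noncentred f x)%E] <=
   (3 ^+ n)%:E * \int[mu]_y `|f y|%:E)%E.
Proof.
move=> mf l0.
pose E := [set p : 'rV[R]_n * R | 0 < p.2 /\ (l%:E < cube_avg f (cube p.1 p.2))%E].
have [F [FE]] := @open_cover_countable _ _ _ (fun p => cube p.1 p.2) E
  (fun p _ => @open_cube _ _ p.1 p.2).
rewrite (_ : \bigcup_(i in E) _ = [set x | (l%:E < HL_noncentred f x)%E]); last first.
  apply/seteqP; split => [x [p [p0 lp]] px|x /ereal_sup_gt[_ [p [p0 px] <-] lp]].
    by apply: (lt_le_trans lp); exact: HL_noncentred_ge.
  by exists p.
move=> ->.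
pose G k := oapp (fun p => cube p.1 p.2) set0 (F k).
have mG k : measurable (G k).
  by rewrite /G; case: (F k) => //= p; exact: measurable_cube.
have mGb k : measurable (\big[setU/set0]_(i < k.+1) G i) by exact: bigsetU_measurable.
rewrite -/G -bigcup_bigsetU_bigcup -lee_pdivlMl//.
have mcvg := @nondecreasing_cvg_mu _ _ _ mu (fun k => \big[setU/set0]_(i < k.+1) G i)
    mGb (bigcup_measurable (fun k _ => mGb k)).
apply: (cvge_to_le (mcvg _)).
  by move=> i j ij; apply/subsetPset/subset_bigsetU.
apply: nearW => k; rewrite lee_pdivlMl//=.
pose s := pmap F (iota 0 k.+1).
have sE p : p \in s -> E p by rewrite mem_pmap => /mapP[j _ /esym/FE].
have [D [Ds dD Dcov]] := vitali_cubes (fun p ps => (sE p ps).1).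
apply: (@le_trans _ _ (l%:E * mu (\big[setU/set0]_(p <- D) cube p.1 (3 * p.2)%R))%E).
  rewrite lee_pmul2l//; apply: le_measure; rewrite ?inE//; [exact: bigsetU_measurable| |].
    by apply: bigsetU_measurable => q _; exact: measurable_cube.
  rewrite -bigcup_mkord => x [j /= jk]; rewrite /G.
  case Fj : (F j) => [p|//] /= px.
  have [|q qD pq] := Dcov p.
    by rewrite mem_pmap; apply/mapP; exists j; rewrite ?mem_iota.
  by rewrite -bigcup_seq; exists q => //; exact: pq.
apply: le_trans (disjoint_cubes_bound mf l0 _ dD _) _.
- by move=> p /Ds/sE[].
- by move=> p /Ds/sE[].
- rewrite lee_pmul2l ?lte_fin ?exprn_gt0//; apply: ge0_subset_integral => //.
    by apply: bigsetU_measurable => q _; exact: measurable_cube.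
  by apply/measurable_EFinP; exact: measurableT_comp.
Qed.

Lemma HL_fin_ae b f : mu.-integrable setT (EFin \o f) ->
  {ae mu, forall x, (HL b f x < +oo)%E}.
Proof.
move=> /integrableP[/measurable_EFinP mf foo].
set N := [set x | (HL_noncentred f x = +oo)%E].
have mN : measurable N.
  have := @measurable_HL false f mf measurableT [set +oo%E] (emeasurable_set1 _).
  by rewrite setTI.
exists N; split => //; last first.
  move=> x /=; apply: contra_notP => /eqP Nx; apply: le_lt_trans (HL_le_noncentred b f x) _.
  by rewrite ltey.
set C := (\int[mu]_y `|f y|%:E)%E in foo.
have C0 : (0 <= C)%E by apply: integral_ge0 => y _; rewrite lee_fin.
have Cfin : C \is a fin_num by rewrite ge0_fin_numE.
have H l : 0 < l -> (l%:E * mu N <= (3 ^+ n * fine C)%:E)%E.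
  move=> l0; rewrite EFinM fineK//; apply: le_trans (maximal_weak_type mf l0).
  rewrite lee_pmul2l// le_measure ?inE//; last by move=> x /= ->; rewrite ltry.
  by apply: open_measurable_rV; exact: open_HL_noncentred.
have mN0 : (0 <= mu N)%E by exact: measure_ge0.
case: (mu N) mN0 H => [r| |]// r0 H; last first.
  by have := H _ ltr01; rewrite mul1e leye_eq.
rewrite lee_fin in r0; congr EFin; apply/eqP; rewrite eq_le r0 andbT leNgt.
apply/negP => rgt0; set K := 3 ^+ n * fine C in H.
have K0 : 0 <= K by rewrite mulr_ge0 ?exprn_ge0// fine_ge0.
(* If the null set candidate had measure [r > 0], the level [(K + 1) / r] would give
   [K + 1 <= K]. *)
have := H ((K + 1) / r); rewrite divr_gt0 ?ltr_wpDl// => /(_ isT).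
by rewrite -EFinM lee_fin mulfVK ?gt_eqF//; lra.
Qed.

End maximal_function.

(** * Smooth bump functions and the fundamental lemma *)

Section smooth_line.
Context {R : realType}.
Implicit Types f g : R -> R.

(** This is [k]-fold differentiability, with no continuity asked of the last derivative; asking it
    for all [k] amounts to smoothness. The derivatives are only required to exist, so closure
    properties follow by induction on [k] without formulas for them. *)
Fixpoint Ck (k : nat) f : Prop :=
  if k is k'.+1 then exists2 f' : R -> R, (forall x : R, is_derive x 1 f (f' x)) & Ck k' f'
  else True.

Lemma CkW k f : Ck k.+1 f -> Ck k f.
Proof.
elim: k f => [//|k IH f [f' ff' kf']].
by exists f' => //; exact: IH.
Qed.

Lemma Ck_cst k (c : R) : Ck k (fun=> c).
Proof. by elim: k c => // k IH c; exists (fun=> 0) => // x; exact: is_derive_cst. Qed.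

Lemma CkD k f g : Ck k f -> Ck k g -> Ck k (fun x => f x + g x).
Proof.
elim: k f g => // k IH f g [f' ff' kf'] [g' gg' kg'].
by exists (fun x => f' x + g' x); [move=> x; exact: is_deriveD|exact: IH].
Qed.

Lemma CkM k f g : Ck k f -> Ck k g -> Ck k (fun x => f x * g x).
Proof.
elim: k f g => // k IH f g fk gk.
move: (CkW fk) (CkW gk) => fk' gk'; case: fk gk => [f' ff' kf'] [g' gg' kg'].
exists (fun x => f x * g' x + g x * f' x); last by apply: CkD; exact: IH.
by move=> x; exact: is_deriveM.
Qed.

Lemma Ck_affine k f (c d : R) : Ck k f -> Ck k (fun x => f (c * x + d)).
Proof.
elim: k f => // k IH f [f' ff' kf'].
exists (fun x => f' (c * x + d) * c).
  move=> x; apply: (@is_derive1_comp _ f (fun x => c * x + d)).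
  have h1 : is_derive x 1 (fun y : R => c * y) (c *: 1) by exact: is_deriveZ.
  by apply: (is_derive_eq (is_deriveD h1 (is_derive_cst d x 1))); rewrite addr0 /GRing.scale/= mulr1.
by apply: CkM; [exact: IH|exact: Ck_cst].
Qed.

(* This family is stable under differentiation, whence the smoothness of
   exp (- 1 / x) extended by 0. *)
Definition exp_inv (k : nat) (x : R) : R :=
  if 0 < x then x^-1 ^+ k * expR (- x^-1) else 0.

Lemma exp_inv_ge0 k x : 0 <= exp_inv k x.
Proof.
rewrite /exp_inv; case: ifPn => // x0.
by rewrite mulr_ge0 ?expR_ge0// exprn_ge0// invr_ge0 ltW.
Qed.

(** This comes from [y ^+ (k + 2) / (k + 2)! <= exp y] at [y = 1 / x]. The exponent 2 on the right
    makes the difference quotient at 0 vanish in the limit. *)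
Lemma exp_inv_le k x : exp_inv k x <= (k.+2)`!%:R * x ^+ 2.
Proof.
rewrite /exp_inv; case: ifPn => x0; last by rewrite mulr_ge0 ?sqr_ge0.
have y0 : 0 < x^-1 by rewrite invr_gt0.
have := expR_ge1Dxn k.+1 (ltW y0); set y := x^-1 in y0 *.
have -> : x = y^-1 by rewrite invrK.
rewrite expRN => H.
rewrite ler_pdivrMr ?expR_gt0//.
have -> : y ^+ k = y ^+ k.+2 * y^-1 ^+ 2.
  by rewrite -addn2 exprD -mulrA -exprMn divff ?gt_eqF// expr1n mulr1.
rewrite [leRHS]mulrAC ler_wpM2r ?sqr_ge0// mulrC -ler_pdivrMr ?ltr0n ?fact_gt0//.
by apply: le_trans H; rewrite lerDr.
Qed.

Lemma is_derive_exp_inv k (x : R) :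
  is_derive x 1 (exp_inv k) (- k%:R * exp_inv k.+1 x + exp_inv k.+2 x).
Proof.
have [x0|x0|->] := ltgtP x 0.
- rewrite /exp_inv !ltNge (ltW x0)/= mulr0 addr0.
  apply: (@near_eq_is_derive _ _ _ (fun=> 0)).
  near=> y; have y0 : y < 0 by near: y; exact: lt_nbhsl.
  by rewrite ltNge (ltW y0).
- have xn0 : x != 0 by rewrite gt_eqF.
  have dV : is_derive x 1 (fun y : R => y^-1) (- x^-1 ^+ 2).
    apply: (is_derive_eq (is_deriveV xn0 (is_derive_id x 1))).
    by rewrite /GRing.scale/= mulr1 exprVn.
  have dE : is_derive x 1 (fun y : R => expR (- y^-1)) (expR (- x^-1) * x^-1 ^+ 2).
    apply: (@is_derive1_comp _ expR (fun y => - y^-1)).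
    by apply: (is_derive_eq (is_deriveN dV)); rewrite opprK.
  have dM := is_deriveM (is_deriveX k dV) dE.
  have fg : \near x, ((fun y : R => y^-1) ^+ k * (fun y => expR (- y^-1))) x = exp_inv k x.
    near=> y; have y0 : 0 < y by near: y; exact: lt_nbhsr.
    by rewrite /exp_inv y0 !fctE.
  apply: (is_derive_eq (near_eq_is_derive fg dM)).
  rewrite /exp_inv x0 /GRing.scale/= !fctE.
  case: k {dM fg} => [|k]; first by rewrite !expr0 mulr0n !mul0r oppr0 mul0r mulr0 addr0 add0r; ring.
  by rewrite /= !exprS; ring.
- have F0 j : exp_inv j 0 = 0 by rewrite /exp_inv ltxx.
  rewrite !F0 mulr0 addr0.
  suff H : h^-1 *: ((exp_inv k \o shift 0) (h *: 1) - exp_inv k 0) @[h --> 0^'] --> 0.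
    by apply: DeriveDef; [apply/cvg_ex; exists 0|exact/cvg_lim].
  apply/cvgrPdist_le => e e0; near=> h.
  rewrite F0 /= sub0r normrN subr0 addr0 /GRing.scale/= mulr1 normrM normfV.
  have hn0 : h != 0 by near: h; exact: nbhs_dnbhs_neq.
  rewrite ler_pdivrMl ?normr_gt0// ger0_norm ?exp_inv_ge0//.
  apply: (le_trans (exp_inv_le _ _)); rewrite -real_normK ?num_real// expr2 mulrA mulrC.
  rewrite ler_wpM2l// mulrC -ler_pdivlMr ?ltr0n ?fact_gt0//.
  near: h; apply: dnbhs0_le; rewrite divr_gt0 ?ltr0n ?fact_gt0//.
Unshelve. all: by end_near. Qed.

Lemma Ck_exp_inv m k : Ck m (exp_inv k).
Proof.
elim: m k => // m IH k; exists (fun x => - k%:R * exp_inv k.+1 x + exp_inv k.+2 x).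
  exact: is_derive_exp_inv.
by apply: CkD => //; apply: CkM => //; exact: Ck_cst.
Qed.

End smooth_line.

Section product_test_functions.
Context {R : realType} {n : nat}.
Implicit Types (phi : 'I_n -> R -> R) (a b x : 'rV[R]_n).

(** Products of one-variable functions are stable under partial derivatives, which reduces
    smoothness in several variables to smoothness on the line. *)
Definition prod_fun phi (x : 'rV[R]_n) : R := \prod_i phi i (x 0 i).

Lemma is_derive_prod_fun phi i x (l : R) : is_derive (x 0 i) 1 (phi i) l ->
  is_derive x (delta_mx 0 i) (prod_fun phi)
    (l * \prod_(j | j != i) phi j (x 0 j)).
Proof.
move=> [dphi phil]; set c := \prod_(j | _) _.
suff H : h^-1 *: ((prod_fun phi \o shift x) (h *: delta_mx 0 i) - prod_fun phi x) @[h --> 0^'] --> l * c.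
  by apply: DeriveDef; [apply/cvg_ex; exists (l * c)|exact/cvg_lim].
have /cvg_ex[l' Hl'] := dphi.
have ll' : l = l' by rewrite -phil; exact/cvg_lim.
rewrite ll'.
have Hc : (fun h => h^-1 *: ((phi i \o shift (x 0 i)) (h *: 1) - phi i (x 0 i)) * c)
    @ 0^' --> l' * c by apply: cvgM Hl' _; exact: cvg_cst.
apply: cvg_trans Hc; apply: near_eq_cvg.
apply: nearW => h /=; rewrite /GRing.scale/= mulr1.
have -> : prod_fun phi x = phi i (x 0 i) * c by rewrite /prod_fun (bigD1 i).
have -> : prod_fun phi (h *: delta_mx 0 i + x) = phi i (h + x 0 i) * c.
  rewrite /prod_fun (bigD1 i)//= !mxE !eqxx mulr1; congr (_ * _).
  by apply: eq_bigr => j ji; rewrite !mxE eqxx (negbTE ji) mulr0 add0r.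
by rewrite -mulrBl mulrA.
Qed.

Definition smooth_line f := forall k, Ck k (f : R -> R).

Lemma smooth_line_derivable f : smooth_line f ->
  exists2 f' : R -> R, (forall x : R, is_derive x 1 f (f' x)) & smooth_line f'.
Proof.
move=> sf; have [f' ff' _] := sf 1%N; exists f' => // k.
have [f'' ff'' kf''] := sf k.+1.
suff -> : f' = f'' by [].
by apply/funext => x; rewrite -(@derive_val _ _ _ _ _ _ _ (ff' x)) -(@derive_val _ _ _ _ _ _ _ (ff'' x)).
Qed.

Lemma partial_prod_fun phi i : (forall j, smooth_line (phi j)) ->
  exists phi', [/\ forall j, smooth_line (phi' j),
    partial i (prod_fun phi) = prod_fun phi' &
    forall x, derivable (prod_fun phi) x (delta_mx 0 i)].
Proof.
move=> sphi; have [f' ff' sf'] := smooth_line_derivable (sphi i).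
exists (fun j => if j == i then f' else phi j).
have D x := is_derive_prod_fun (ff' (x 0 i)).
split; [by move=> j; case: eqP| |by move=> x; case: (D x) => dx _; exact: dx].
apply/funext => x; rewrite /partial; have [_ ->] := D x.
rewrite /prod_fun [RHS](bigD1 i)//= eqxx; congr (_ * _).
by apply: eq_bigr => j /negbTE ->.
Qed.

Lemma continuous_prod_fun phi : (forall j, continuous (phi j)) ->
  continuous (prod_fun phi).
Proof.
move=> cphi; rewrite /prod_fun; elim: (index_enum _) => [|i s IH].
  rewrite (_ : (fun x => _) = fun=> 1); first by move=> x; exact: cst_continuous.
  by apply/funext => x; rewrite big_nil.
rewrite (_ : (fun x => _) = (fun x : 'rV[R]_n => phi i (x 0 i) * \prod_(j <- s) phi j (x 0 j))).
  move=> x; apply: (@cvgM _ _ (nbhs x)); last exact: IH.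
  apply: (@cvg_comp _ _ _ (fun y : 'rV[R]_n => y 0 i) (phi i) _ (nbhs (x 0 i))).
    exact: coord_continuous.
  exact: cphi.
by apply/funext => x; rewrite big_cons.
Qed.

Lemma smooth_line_continuous (f : R -> R) : smooth_line f -> continuous f.
Proof.
move=> /smooth_line_derivable[f' ff' _] x.
apply/differentiable_continuous/derivable1_diffP.
by have [] := ff' x.
Qed.

Lemma smooth_prod_fun phi : (forall j, smooth_line (phi j)) -> smooth (prod_fun phi).
Proof.
move=> sphi s.
have [phi' [sphi' ->]] : exists phi', (forall j, smooth_line (phi' j)) /\
    iter_partial s (prod_fun phi) = prod_fun phi'.
  elim: s => [|i s [phi' [sphi' IH]]]; first by exists phi.
  by have [phi'' [? ? _]] := partial_prod_fun i sphi'; exists phi''; rewrite /= IH.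
split; first by apply: continuous_prod_fun => j; exact: smooth_line_continuous.
by move=> x i; have [_ [_ _]] := partial_prod_fun i sphi'; exact.
Qed.

Lemma test_prod_fun phi a b : (forall j, smooth_line (phi j)) ->
  (forall j t, phi j t != 0 -> a 0 j <= t <= b 0 j) -> test_function (prod_fun phi).
Proof.
move=> sphi phi0; split; first exact: smooth_prod_fun.
have cK : compact [set x : 'rV[R]_n | forall i, `[a 0 i, b 0 i]%classic (x 0 i)].
  by apply: (@rV_compact R n (fun i => `[a 0 i, b 0 i]%classic)) => i; exact: segment_compact.
apply: (subclosed_compact _ cK); first exact: closed_closure.
have : closed [set x : 'rV[R]_n | forall i, `[a 0 i, b 0 i]%classic (x 0 i)].
  by apply: compact_closed => //; exact: norm_hausdorff.
move=> /closure_id ->; apply: closureS => x /= /prodf_neq0 H i.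
by rewrite /= in_itv/=; apply: phi0; exact: H.
Qed.

(** Each factor has the form [exp (- 1 / ((k + 1) s))], where [s] is the signed distance to a face,
    and is 0 for [s <= 0]. Thus the bumps take values in [[0, 1]] and tend pointwise to the
    indicator of the open box. *)
Definition box_bump a b (k : nat) : 'rV[R]_n -> R := prod_fun (fun i t =>
  exp_inv 0 (k.+1%:R * (t - a 0 i)) * exp_inv 0 (k.+1%:R * (b 0 i - t))).

Lemma exp_inv0_gt0 (t : R) : (exp_inv 0 t != 0) = (0 < t).
Proof.
rewrite /exp_inv expr0 mul1r; case: ifPn => [t0|_]; last by rewrite eqxx.
by rewrite gt_eqF// expR_gt0.
Qed.

Lemma exp_inv0_le1 (t : R) : exp_inv 0 t <= 1.
Proof.
rewrite /exp_inv expr0 mul1r; case: ifPn => // t0.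
by rewrite -expR0 ler_expR oppr_le0 invr_ge0 ltW.
Qed.

Lemma test_box_bump a b k : test_function (box_bump a b k).
Proof.
apply: (@test_prod_fun _ a b) => [j m|j t].
  apply: CkM.
    rewrite (_ : (fun t => _) = fun t => exp_inv 0 (k.+1%:R * t + (- (k.+1%:R * a 0 j)))).
      by apply: Ck_affine; exact: Ck_exp_inv.
    by apply/funext => t; rewrite mulrBr.
  rewrite (_ : (fun t => _) = fun t => exp_inv 0 ((- k.+1%:R) * t + k.+1%:R * b 0 j)).
    by apply: Ck_affine; exact: Ck_exp_inv.
  by apply/funext => t; congr exp_inv; rewrite mulrBr mulNr addrC.
rewrite mulf_eq0 negb_or !exp_inv0_gt0 !pmulr_rgt0// !subr_gt0.
by move=> /andP[/ltW -> /ltW ->].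
Qed.

Lemma box_bump_ge0 a b k x : 0 <= box_bump a b k x.
Proof. by apply: prodr_ge0 => i _; rewrite mulr_ge0 ?exp_inv_ge0. Qed.

Lemma box_bump_le1 a b k x : box_bump a b k x <= 1.
Proof.
rewrite /box_bump /prod_fun -[leRHS](@big1_eq _ _ *%R _ (index_enum 'I_n) xpredT).
apply: ler_prod => i _; rewrite mulr_ge0 ?exp_inv_ge0//=.
by rewrite mulr_ile1 ?exp_inv_ge0 ?exp_inv0_le1.
Qed.

Lemma cvg_exp_inv0 (t : R) : exp_inv 0 (k.+1%:R * t) @[k --> \oo] --> ((0 < t)%R%:R : R).
Proof.
have [t0|t0] := ltP 0 t; last first.
  rewrite (_ : (fun k => _) = fun=> 0); first exact: cvg_cst.
  apply/funext => k; apply/eqP; rewrite -[_ == _]negbK exp_inv0_gt0.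
  by rewrite pmulr_rgt0// ltNge t0.
rewrite (_ : (fun k => _) = fun k => expR (- t^-1 * k.+1%:R^-1)); last first.
  by apply/funext => k; rewrite /exp_inv pmulr_rgt0// t0 expr0 mul1r invfM mulNr mulrC.
have -> : 1%:R = expR (- t^-1 * 0) :> R by rewrite mulr0 expR0.
apply: (@cvg_comp _ _ _ (fun k : nat => - t^-1 * k.+1%:R^-1) expR); last exact: continuous_expR.
by apply: cvgMr; exact: cvg_harmonic.
Qed.

Lemma cvg_box_bump a b x : box_bump a b k x @[k --> \oo] --> (\1_(box a b) x : R).
Proof.
have -> : \1_(box a b) x = \prod_i ((0 < x 0 i - a 0 i)%R%:R * (0 < b 0 i - x 0 i)%R%:R) :> R.
  rewrite indicE; have [xab|/negP] := boolP (x \in box a b).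
    move: xab; rewrite inE => xab; rewrite big1// => i _.
    by have /andP[ax xb] := xab i; rewrite !subr_gt0 ax xb mulr1.
  rewrite inE => /existsNP[i /negP xab]; rewrite (bigD1 i)//=.
  by move: xab; rewrite !subr_gt0; case: (_ < _) => //=; case: (_ < _) => //= _;
    rewrite ?mulr0 ?mul0r.
rewrite /box_bump /prod_fun; elim: (index_enum _) => [|i s IH].
  rewrite big_nil (_ : (fun k => _) = fun=> 1); first exact: cvg_cst.
  by apply/funext => k; rewrite big_nil.
rewrite big_cons (_ : (fun k => _) = (fun k =>
    exp_inv 0 (k.+1%:R * (x 0 i - a 0 i)) * exp_inv 0 (k.+1%:R * (b 0 i - x 0 i)) *
    \prod_(j <- s) (exp_inv 0 (k.+1%:R * (x 0 j - a 0 j)) *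
      exp_inv 0 (k.+1%:R * (b 0 j - x 0 j))))).
  by apply: cvgM => //; apply: cvgM; exact: cvg_exp_inv0.
by apply/funext => k; rewrite big_cons.
Qed.

End product_test_functions.

Lemma integral_mul_indic d (T : measurableType d) (R : realType)
    (mu : {measure set T -> \bar R}) (D : set T) (f : T -> R) :
  (\int[mu]_x (f x * \1_D x)%:E = \int[mu]_(x in D) (f x)%:E)%E.
Proof.
rewrite [RHS]integral_mkcond; apply: eq_integral => x _.
by rewrite patchE indicE; case: ifP => _; rewrite (mulr1, mulr0).
Qed.

Section fundamental_lemma.
Context {R : realType} {n : nat}.
Local Notation mu := (lebesgue_rV R n).

Lemma test_continuous (phi : 'rV[R]_n -> R) : test_function phi -> continuous phi.
Proof. by move=> [sphi _]; have [] := sphi [::]. Qed.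

(** By dominated convergence along the bumps, [w] has integral 0 over every box. Its positive and
    negative parts are then densities of two measures that agree on boxes, hence everywhere. *)
Lemma fundamental_lemma (w : 'rV[R]_n -> R) : mu.-integrable setT (EFin \o w) ->
  (forall phi, test_function phi -> (\int[mu]_x (w x * phi x)%:E = 0)%E) ->
  {ae mu, forall x, w x = 0}.
Proof.
move=> iw H; have mw : measurable_fun setT w by apply/measurable_EFinP; case/integrableP : iw.
have wbox a b : (\int[mu]_(x in box a b) (w x)%:E = 0)%E.
  have f_f : forall x, setT x -> (fun k => (w x * box_bump a b k x)%:E) @ \oo -->
      (w x * \1_(box a b) x)%:E.
    move=> x _; apply: cvg_EFin; first exact: nearW.
    by apply: cvgM; [exact: cvg_cst|exact: cvg_box_bump].
  rewrite -integral_mul_indic.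
  have cv : (\int[mu]_x (w x * box_bump a b k x)%:E)%E @[k --> \oo] -->
      (\int[mu]_x (w x * \1_(box a b) x)%:E)%E.
    apply: (@dominated_cvg _ _ _ mu setT measurableT
      (fun k x => (w x * box_bump a b k x)%:E) _ (fun x => `|w x|%:E)) => //.
    - move=> k; apply/measurable_EFinP; apply: measurable_funM => //.
      by apply: continuous_measurable_rV; apply: test_continuous; exact: test_box_bump.
    - exact: integrable_norm.
    - move=> k x _; rewrite abse_EFin lee_fin normrM (ger0_norm (box_bump_ge0 _ _ _ _)).
      by rewrite ler_piMr ?box_bump_le1.
  have bump0 : (fun k => \int[mu]_x (w x * box_bump a b k x)%:E)%E = cst 0%E.
    by apply/funext => k; apply: H; exact: test_box_bump.
  by rewrite bump0 in cv; apply: (cvg_unique _ cv (cvg_cst _)).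
have [m1 m1E] := @density_measure _ _ _ mu (EFin \o w)^\+%E
  (measurable_funepos (measurable_int _ iw)) (fun x => funepos_ge0 _ x).
have [m2 m2E] := @density_measure _ _ _ mu (EFin \o w)^\-%E
  (measurable_funeneg (measurable_int _ iw)) (fun x => funeneg_ge0 _ x).
have ibox A : measurable A -> mu.-integrable A (EFin \o w).
  by move=> mA; exact: integrableS iw.
have m1oo A : measurable A -> (m1 A < +oo)%E.
  by move=> mA; rewrite m1E; apply: integral_funepos_lt_pinfty => //; exact: ibox.
have m2oo A : measurable A -> (m2 A < +oo)%E.
  by move=> mA; rewrite m2E; apply: integral_funeneg_lt_pinfty => //; exact: ibox.
have intE A : (\int[mu]_(x in A) (w x)%:E = m1 A - m2 A)%E.
  by rewrite integralE m1E m2E.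
have m12 : forall A, measurable A -> m1 A = m2 A.
  apply: rV_measure_unique => a b; first by apply: m1oo; exact: measurable_box.
  have m2fin : m2 (box a b) \is a fin_num.
    by rewrite ge0_fin_numE// m2oo//; exact: measurable_box.
  by rewrite -[LHS](subeK _ m2fin) -intE wbox add0e.
have := @integral_ae_eq _ _ _ mu setT measurableT (cst 0%E) (EFin \o w) iw
  (measurable_cst _).
move=> /(_ _)[|N [mN N0 NP]].
  move=> A _ mA; rewrite integral0 intE m12// subee// ge0_fin_numE//.
  exact: m2oo.
exists N; split => //; apply: subset_trans NP => x /= wx /(_ I).
by move=> [].
Qed.

End fundamental_lemma.

(** * Fubini along parallel lines *)

Section lines.
Context {R : realType} {n : nat} (e : 'rV[R]_n).
Local Notation mu := (lebesgue_rV R n).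
Local Notation leb := (@lebesgue_measure R).

Lemma measurable_line :
  measurable_fun [set: 'rV[R]_n * measurableTypeR R] (fun p => p.1 + (p.2 : R) *: e).
Proof.
apply: measurable_rV_add; first exact: measurable_fst.
by apply: measurable_rV_scale; exact: measurable_snd.
Qed.

Lemma measurable_line_at x :
  measurable_fun [set: measurableTypeR R] (fun s : R => x + s *: e).
Proof.
by apply: measurable_rV_add; [exact: measurable_cst|exact: measurable_rV_scale].
Qed.

(** By Tonelli and translation invariance, the integral over [x] of these line integrals is the
    length of [[a, b]] times the integral of [f]. *)
Lemma line_integral_lty (f : 'rV[R]_n -> \bar R) (a b : R) :
  measurable_fun setT f -> (forall x, (0 <= f x)%E) ->
  (\int[mu]_x f x < +oo)%E ->
  {ae mu, forall x, (\int[leb]_(s in `[a, b]) f (x + (s : R) *: e)%R < +oo)%E}.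
Proof.
move=> mf f0 foo.
pose F (p : 'rV[R]_n * measurableTypeR R) : \bar R :=
  (f (p.1 + (p.2 : R) *: e)%R * (\1_(`[a, b]%classic : set R) (p.2 : R))%:E)%E.
have mF : measurable_fun setT F.
  apply: emeasurable_funM.
    by apply: (measurableT_comp mf); exact: measurable_line.
  apply/measurable_EFinP; apply: measurableT_comp; last exact: measurable_snd.
  by apply: measurable_indic.
have F0 p : (0 <= F p)%E by rewrite /F mule_ge0// lee_fin.
have FE x : (\int[leb]_s F (x, s) = \int[leb]_(s in `[a, b]) f (x + (s : R) *: e)%R)%E.
  rewrite [RHS]integral_mkcond; apply: eq_integral => s _.
  by rewrite patchE /F/= indicE; case: ifP => _; rewrite (mule1, mule0).
have iF : mu.-integrable setT (fun x => \int[leb]_s F (x, s))%E.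
  apply/integrableP; split; first exact: measurable_fun_fubini_tonelli_F.
  under eq_integral => x _ do (rewrite gee0_abs; last exact: integral_ge0).
  rewrite [ltLHS](_ : _ = \int[leb]_s ((\int[mu]_x f x) * (\1_(`[a, b]%classic : set R) s)%:E))%E.
    rewrite ge0_integralZl//; last 2 first.
    - by apply/measurable_EFinP; exact: measurable_indic.
    - exact: integral_ge0.
    rewrite integral_indic// setIT lte_mul_pinfty//; first exact: integral_ge0.
      by rewrite ge0_fin_numE//; exact: integral_ge0.
    have := lebesgue_measure_itv `[a, b]; rewrite /= => ->; case: ifP => _ //.
    by rewrite -EFinB ltry.
  rewrite (fubini_tonelli _ mF)//; apply: eq_integral => s _.
  rewrite /fubini_G /F/= ge0_integralZr//.
  - by rewrite (ge0_integral_shift _ mf).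
  - by apply: (measurableT_comp mf); exact: measurable_shift.
have aeF : Filter (almost_everywhere mu) := ae_filter_ringOfSetsType mu.
apply: filterS (integrable_ae measurableT iF) => x /(_ I).
by rewrite FE ge0_fin_numE//; exact: integral_ge0.
Qed.

(** Fubini on the product of the space with [[0, t]], followed for each [s] by a translation that
    moves the shift from [q] to [phi], where it can be differentiated. *)
Lemma line_fubini (q phi : 'rV[R]_n -> R) (B t : R) :
  mu.-integrable setT (EFin \o q) -> measurable_fun setT phi ->
  (forall x, `|phi x| <= B) ->
  [/\ mu.-integrable setT (fun x => \int[leb]_(s in `[0%R, t]) (q (x + (s : R) *: e)%R)%:E)%E,
   {ae mu, forall x, leb.-integrable `[0%R, t] (fun s => (q (x + (s : R) *: e)%R)%:E)} &
   (\int[mu]_x ((phi x)%:E * \int[leb]_(s in `[0%R, t]) (q (x + (s : R) *: e)%R)%:E) =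
   \int[leb]_(s in `[0%R, t]) \int[mu]_x (q x * phi (x - (s : R) *: e)%R)%:E)%E].
Proof.
move=> iq mphi phiB.
have mq : measurable_fun setT q by apply/measurable_EFinP; case/integrableP : iq.
pose I1 (s : R) : R := \1_(`[0%R, t]%classic : set R) s.
have I1_ge0 s : 0 <= I1 s by rewrite /I1 indicE.
have mI1 : measurable_fun setT I1 by exact: measurable_indic.
pose Q (p : 'rV[R]_n * measurableTypeR R) : R := q (p.1 + (p.2 : R) *: e)%R * I1 p.2.
have mQ : measurable_fun setT Q.
  apply: measurable_funM; first by apply: (measurableT_comp mq); exact: measurable_line.
  by apply: (measurableT_comp mI1); exact: measurable_snd.
have absQ p : (`|(Q p)%:E| = `|q (p.1 + (p.2 : R) *: e)%R|%:E * (I1 p.2)%:E)%E.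
  by rewrite abse_EFin -EFinM normrM [`|I1 _|]ger0_norm.
have lebt : (leb `[0%R, t]%classic < +oo)%E.
  have := lebesgue_measure_itv `[(0 : R), t]; rewrite /= => ->; case: ifP => _ //.
  by rewrite -EFinB ltry.
have iQ : (mu \x leb)%E.-integrable setT (EFin \o Q).
  apply/integrable21ltyP; first exact/measurable_EFinP.
  rewrite [ltLHS](_ : _ = \int[leb]_s ((\int[mu]_x `|q x|%:E) * (I1 s)%:E))%E; last first.
    apply: eq_integral => s _; under eq_integral => x _ do rewrite absQ/=.
    rewrite ge0_integralZr//.
    - rewrite (@ge0_integral_shift _ _ _ (fun x => `|q x|%:E))//.
      by apply/measurable_EFinP; exact: measurableT_comp.
    - apply/measurable_EFinP; apply: measurableT_comp => //.
      by apply: (measurableT_comp mq); exact: measurable_shift.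
    - by rewrite lee_fin.
  have qge0 : (0 <= \int[mu]_x `|q x|%:E)%E by apply: integral_ge0 => x _; rewrite lee_fin.
  have mEI1 : measurable_fun setT (fun s => (I1 s)%:E) by exact/measurable_EFinP.
  rewrite (ge0_integralZl leb measurableT mEI1)//; last first.
    by move=> s _; rewrite lee_fin.
  rewrite integral_indic// setIT lte_mul_pinfty//.
  by case/integrableP : iq => _; rewrite ge0_fin_numE.
have QE x : (\int[leb]_s (Q (x, s))%:E =
    \int[leb]_(s in `[0%R, t]) (q (x + (s : R) *: e)%R)%:E)%E.
  exact: (integral_mul_indic leb `[0%R, t]%classic (fun s : R => q (x + s *: e))).
have iS : mu.-integrable setT
    (fun x => \int[leb]_(s in `[0%R, t]) (q (x + (s : R) *: e)%R)%:E)%E.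
  have := integrable_fubini_F iQ; apply: eq_integrable => // x _.
  by rewrite /fubini_F -QE.
have aeQ : {ae mu, forall x, leb.-integrable setT (fun s => (Q (x, s))%:E)}.
  exact: ae_integrable1 iQ.
have aeF : Filter (almost_everywhere mu) := ae_filter_ringOfSetsType mu.
split => //.
  apply: filterS aeQ => x ix; apply/(integrable_mkcond _ _).2 => //.
  apply: eq_integrable ix => // s _.
  by rewrite /Q /I1/= patchE indicE; case: ifP => _; rewrite (mulr1, mulr0).
pose P (p : 'rV[R]_n * measurableTypeR R) : R := phi p.1 * Q p.
have mP : measurable_fun setT P.
  by apply: measurable_funM => //; apply: (measurableT_comp mphi); exact: measurable_fst.
have iP : (mu \x leb)%E.-integrable setT (EFin \o P).
  apply: le_integrable (integrableZl measurableT B iQ) => //; first exact/measurable_EFinP.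
  move=> p _; rewrite -EFinM !abse_EFin lee_fin !normrM ler_wpM2r// ?mulr_ge0//.
  by rewrite (le_trans (phiB _))// ler_norm.
transitivity (\int[mu]_x \int[leb]_s (P (x, s))%:E)%E.
  apply: ae_eq_integral => //.
  - apply: emeasurable_funM; first exact/measurable_EFinP.
    exact: measurable_int iS.
  - exact: measurable_fubini_F iP.
  - apply: filterS aeQ => x ix _; rewrite -QE -integralZl//.
transitivity (\int[leb]_s \int[mu]_x (P (x, s))%:E)%E; first exact: Fubini iP.
rewrite [RHS]integral_mkcond; apply: eq_integral => s _.
rewrite patchE /P /Q /I1 /= indicE; case: ifP => _; last first.
  by rewrite (eq_integral (cst 0%E)) ?integral0// => x _; rewrite !mulr0.
rewrite -(integral_shift (- (s *: e)) (f := fun x => _)); last first.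
  apply/measurable_EFinP; apply: measurable_funM => //; apply: measurable_funM => //.
  by apply: (measurableT_comp mq); exact: measurable_shift.
by apply: eq_integral => x _; rewrite subrK mulr1 mulrC.
Qed.

End lines.

(** * Translations of Sobolev functions *)

Section test_function_closure.
Context {R : realType} {n : nat}.
Implicit Types (phi : 'rV[R]_n -> R) (x z : 'rV[R]_n).

Lemma compact_supp phi (K : set 'rV[R]_n) :
  compact K -> (forall x, phi x != 0 -> K x) -> compact (supp phi).
Proof.
move=> cK phiK; have clK : closed K by apply: compact_closed => //; exact: norm_hausdorff.
apply: (subclosed_compact _ cK); first exact: closed_closure.
by rewrite [X in _ `<=` X](closure_id _).1//; exact: closureS.
Qed.

Lemma supp_out phi x : ~ supp phi x -> phi x = 0.
Proof.
move=> nsx; apply/eqP/negPn/negP => phix; apply: nsx; exact: subset_closure.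
Qed.

Lemma nbhs_supp_out phi x : ~ supp phi x -> \near x, phi x = 0.
Proof.
move=> nsx; have oC : open (~` supp phi) by apply: closed_openC; exact: closed_closure.
by apply: filterS (open_nbhs_nbhs (conj oC nsx)) => y; exact: supp_out.
Qed.

Lemma partial_supp i phi x : ~ supp phi x -> partial i phi x = 0.
Proof.
move=> /nbhs_supp_out H; rewrite /partial (near_eq_derive _ (g := cst 0)) ?derive_cst//.
Qed.

Lemma test_partial i phi : test_function phi -> test_function (partial i phi).
Proof.
move=> [sphi cphi]; split.
  by move=> s; have := sphi (rcons s i); rewrite /iter_partial foldr_rcons.
apply: (compact_supp cphi) => x; apply: contra_neqP => /=.
exact: partial_supp.
Qed.

Lemma partial_shift i phi z :
  partial i (fun x => phi (x + z)) = fun x => partial i phi (x + z).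
Proof.
apply/funext => x; rewrite /partial /derive.
rewrite (_ : (fun h => h^-1 *: (((fun x => phi (x + z)) \o shift x) _ - _)) =
  (fun h => h^-1 *: ((phi \o shift (x + z)) (h *: delta_mx 0 i) - phi (x + z))))//.
by apply/funext => h /=; rewrite addrA.
Qed.

Lemma test_shift phi z : test_function phi -> test_function (fun x => phi (x + z)).
Proof.
move=> [sphi cphi].
have cz w : continuous (fun x : 'rV[R]_n => x + w).
  by move=> x; apply: (@cvgD _ _ _ (nbhs x)); [exact: cvg_id|exact: cvg_cst].
split.
  move=> s; have -> : iter_partial s (fun x => phi (x + z)) = fun x => iter_partial s phi (x + z).
    by elim: s => // i s IH; rewrite /= IH partial_shift.
  have [cs ds] := sphi s; split.
    by move=> x; apply: (@continuous_comp _ _ _ (fun x => x + z)); [exact: cz|exact: cs].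
  move=> x i; have H := ds (x + z) i.
  suff E : (fun h : R => h^-1 *: (((fun x => iter_partial s phi (x + z)) \o shift x)
        (h *: delta_mx 0 i) - iter_partial s phi (x + z))) =
      (fun h : R => h^-1 *: ((iter_partial s phi \o shift (x + z))
        (h *: delta_mx 0 i) - iter_partial s phi (x + z))).
    by rewrite /derivable E.
  by apply/funext => h /=; rewrite addrA.
have cK : compact ((fun x => x - z) @` supp phi).
  apply: continuous_compact => //; apply: continuous_subspaceT; exact: cz.
apply: (compact_supp cK) => x phix; exists (x + z).
  exact: subset_closure.
by rewrite addrK.
Qed.

Lemma test_bounded phi : test_function phi -> exists B, forall x, `|phi x| <= B.
Proof.
move=> tphi; have cphi := test_continuous tphi; case: (tphi) => _ cs.
have : compact (phi @` supp phi).
  by apply: continuous_compact => //; exact: continuous_subspaceT.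
move=> /compact_bounded[M [_ /(_ (M + 1))]]; rewrite ltrDl ltr01 => /(_ isT) MB.
exists (Num.max (M + 1) 0) => x; rewrite le_max.
have [sx|/supp_out ->] := pselect (supp phi x); last by rewrite normr0 lexx orbT.
by apply/orP; left; apply: MB; exists x.
Qed.

Lemma test_measurable phi : test_function phi -> measurable_fun setT phi.
Proof. by move=> /test_continuous; exact: continuous_measurable_rV. Qed.

Lemma is_derive_test_line i phi x (s : R) : test_function phi ->
  is_derive s 1 (fun s : R => phi (x - s *: delta_mx 0 i))
    (- partial i phi (x - s *: delta_mx 0 i)).
Proof.
move=> [/(_ [::])[_ dphi] _]; set e := delta_mx 0 i.
have /cvg_ex[l Hl] := dphi (x - s *: e) i.
have -> : partial i phi (x - s *: e) = l by apply/cvg_lim.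
suff H : h^-1 *: (((fun s : R => phi (x - s *: e)) \o shift s) (h *: 1) - phi (x - s *: e))
    @[h --> 0^'] --> - l.
  by apply: DeriveDef; [apply/cvg_ex; exists (- l)|exact/cvg_lim].
have N0 : (fun h : R => - h) @ 0^' --> 0^'.
  move=> A [r /= r0 rA]; exists r => // y /= yr y0; apply: rA => /=.
    by move: yr; rewrite !sub0r !normrN.
  by rewrite oppr_eq0.
have HN := cvgN (cvg_comp (fun h : R => - h) _ N0 Hl).
suff E : (fun h : R => h^-1 *: (((fun s : R => phi (x - s *: e)) \o shift s) (h *: 1) -
      phi (x - s *: e))) =
    - ((fun h : R => h^-1 *: ((phi \o shift (x - s *: e)) (h *: e) - phi (x - s *: e))) \o
       (fun h : R => - h)).
  by rewrite E; exact: HN.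
apply/funext => h /=; rewrite !fctE/= invrN scaleNr opprK.
rewrite [h *: 1]mulr1 scalerDl opprD; congr (_ *: (phi _ - _)).
by rewrite scaleNr addrCA.
Qed.

End test_function_closure.

Section integral_along_line.
Context {R : realType} {n : nat} (i : 'I_n).
Implicit Types (w phi : 'rV[R]_n -> R).
Local Notation mu := (lebesgue_rV R n).
Local Notation leb := (@lebesgue_measure R).
Local Notation e := (delta_mx 0 i : 'rV[R]_n).

(* By translation this is the integral of w (x + s e) phi x; in this form, its
   smoothness in s does not require any of w. *)
Definition line_corr w phi (s : R) : R := (\int[mu]_x (w x * phi (x - s *: e)))%R.

Lemma integrable_mul_bounded w phi B : mu.-integrable setT (EFin \o w) ->
  measurable_fun setT phi -> (forall x, `|phi x| <= B) ->
  mu.-integrable setT (fun x => (w x * phi x)%:E).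
Proof.
move=> iw mphi phiB.
have mw : measurable_fun setT w by apply/measurable_EFinP; case/integrableP : iw.
apply: le_integrable (integrableZl measurableT B iw) => //.
  by apply/measurable_EFinP; exact: measurable_funM.
move=> x _; rewrite -EFinM !abse_EFin lee_fin !normrM mulrC ler_wpM2r//.
by rewrite (le_trans (phiB _))// ler_norm.
Qed.

Lemma integrable_mul_test w phi z : mu.-integrable setT (EFin \o w) ->
  test_function phi -> mu.-integrable setT (fun x => (w x * phi (x + z))%:E).
Proof.
move=> iw tphi; have tz := test_shift z tphi; have [B HB] := test_bounded tz.
by apply: (integrable_mul_bounded iw _ HB); exact: test_measurable.
Qed.

Lemma line_corrE w phi s : mu.-integrable setT (EFin \o w) -> test_function phi ->
  ((line_corr w phi s)%:E = \int[mu]_x (w x * phi (x - s *: e)%R)%:E)%E.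
Proof.
move=> iw tphi; rewrite /line_corr /Rintegral fineK//.
by apply: integrable_fin_num => //; exact: integrable_mul_test.
Qed.

Lemma continuous_line_corr w phi : mu.-integrable setT (EFin \o w) ->
  test_function phi -> continuous (line_corr w phi).
Proof.
move=> iw tphi s; have [B HB] := test_bounded tphi.
have := @continuity_under_integral R _ _ mu (fun s x => w x * phi (x - s *: e)) setT
  measurableT (s - 1) (s + 1) _ _ (fun x => B * `|w x|) _ _ s.
apply.
- by move=> r _; exact: integrable_mul_test.
- apply: aeW => x _ r _; apply: cvgM; first exact: cvg_cst.
  have [dr _] := is_derive_test_line i x r tphi.
  by apply/differentiable_continuous/derivable1_diffP.
- have := integrableZl measurableT B (integrable_norm iw); exact: eq_integrable.
- move=> r _; apply: aeW => x _; rewrite normrM mulrC ler_wpM2r//.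
- by rewrite inE/= in_itv/=; apply/andP; split; lra.
Qed.

Lemma is_derive_line_corr w phi (s : R) : mu.-integrable setT (EFin \o w) ->
  test_function phi ->
  is_derive s 1 (line_corr w phi) (- line_corr w (partial i phi) s).
Proof.
move=> iw tphi; have tp := test_partial i tphi; have [B HB] := test_bounded tp.
pose f (s : R) x := w x * phi (x - s *: e).
have df (r : R) x : is_derive r 1 (f ^~ x) (w x * - partial i phi (x - r *: e)).
  have dphi := is_derive_test_line i x r tphi.
  have dZ : is_derive r 1 (w x *: (fun r : R => phi (x - r *: e)))
      (w x *: - partial i phi (x - r *: e)) by exact: is_deriveZ.
  exact: dZ.
have H1 : forall r : R, `]s - 1, s + 1[%classic r -> mu.-integrable setT (EFin \o f r).
  by move=> r _; exact: integrable_mul_test.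
have Is : `]s - 1, s + 1[%classic s by rewrite /= in_itv/=; apply/andP; split; lra.
have H2 (r : R) x : `]s - 1, s + 1[%classic r -> setT x -> derivable (f ^~ x) r 1.
  by move=> _ _; have [] := df r x.
have H3 : mu.-integrable setT (EFin \o (fun x => B * `|w x|)).
  by have := integrableZl measurableT B (integrable_norm iw); exact: eq_integrable.
have B0 : 0 <= B by exact: le_trans (normr_ge0 _) (HB 0).
have H4 x : 0 <= B * `|w x| by rewrite mulr_ge0.
have H5 (r : R) x : `]s - 1, s + 1[%classic r -> setT x ->
    `|partial1of2 f r x| <= B * `|w x|.
  move=> _ _; rewrite partial1of2E; have [_ ->] := df r x.
  by rewrite normrM normrN mulrC ler_wpM2r.
have D := derivable_under_integral measurableT Is H1 H2 H4 H3 H5.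
have E := differentiation_under_integral measurableT Is H1 H2 H4 H3 H5.
apply: DeriveDef; first exact: D.
rewrite -derive1E [LHS]E /line_corr.
rewrite (eq_Rintegral _ (g := fun x => (-1) * (w x * partial i phi (x - s *: e)))).
  rewrite RintegralZl ?mulN1r//; exact: integrable_mul_test.
by move=> x _; rewrite partial1of2E; have [_ ->] := df s x; rewrite mulrN mulN1r.
Qed.

End integral_along_line.

Section sobolev_translation.
Context {R : realType} {n : nat} (i : 'I_n).
Local Notation mu := (lebesgue_rV R n).
Local Notation leb := (@lebesgue_measure R).
Local Notation e := (delta_mx 0 i : 'rV[R]_n).

Lemma line_corr_FTC (w v phi : 'rV[R]_n -> R) (t : R) :
  mu.-integrable setT (EFin \o w) -> mu.-integrable setT (EFin \o v) ->
  test_function phi ->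
  (forall s, - line_corr i w (partial i phi) s = line_corr i v phi s) -> 0 < t ->
  (\int[leb]_(s in `[0%R, t]) (line_corr i v phi s)%:E =
   (line_corr i w phi t)%:E - (line_corr i w phi 0)%:E)%E.
Proof.
move=> iw iv tphi wv t0.
have D s := is_derive_line_corr i s iw tphi.
have dD s : derivable (line_corr i w phi) s 1 by have [] := D s.
have cD : continuous (line_corr i w phi).
  by move=> s; apply/differentiable_continuous/derivable1_diffP.
apply: continuous_FTC2 => //.
- by apply: continuous_subspaceT; exact: continuous_line_corr.
- split; first by move=> s _; exact: dD.
  + by apply: cvg_at_right_filter; exact: cD.
  + by apply: cvg_at_left_filter; exact: cD.
- by move=> s _; rewrite derive1E; have [_ ->] := D s; exact: wv.
Qed.

(** The weak derivative is tested against the translate of [phi] by [s e]; the result is a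
    differential equation in [s] for the correlation. *)
Lemma weak_partial_line_corr (w v phi : 'rV[R]_n -> R) s :
  mu.-integrable setT (EFin \o w) -> mu.-integrable setT (EFin \o v) ->
  weak_partial_off set0 i (EFin \o w) v -> test_function phi ->
  - line_corr i w (partial i phi) s = line_corr i v phi s.
Proof.
move=> iw iv wv tphi; have tz := test_shift (- (s *: e)) tphi.
have [_ _] := wv _ tz (setI0 _); rewrite partial_shift => H.
apply/EFin_inj; rewrite EFinN !line_corrE//; last exact: test_partial.
Qed.

(** Tested against [phi], the difference of the two sides is the increment over [[0, t]] of the
    correlation of [u] minus the integral of the correlation of [v]. It vanishes by [line_corr_FTC],
    and the fundamental lemma concludes. *)
Lemma sobolev_translation (u v : 'rV[R]_n -> R) (t : R) :
  mu.-integrable setT (EFin \o u) -> mu.-integrable setT (EFin \o v) ->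
  weak_partial_off set0 i (EFin \o u) v -> 0 < t ->
  {ae mu, forall x, ((u (x + t *: e) - u x)%:E =
     \int[leb]_(s in `[0%R, t]) (v (x + (s : R) *: e)%R)%:E)%E}.
Proof.
move=> iu iv uv t0.
pose S x := (\int[leb]_(s in `[0%R, t]) (v (x + (s : R) *: e)%R)%:E)%E.
(* Only the integrability of [S] is extracted here, hence the zero function in place of a test
   function. *)
have [iS _ _] := line_fubini e t iv (measurable_cst (0 : R))
  (fun _ => ltac:(by rewrite normr0) : `|cst (0 : R) _| <= 0).
have ifS : mu.-integrable setT (EFin \o (fine \o S)).
  apply: le_integrable (iS) => //.
    apply/measurable_EFinP; apply: (measurableT_comp (@fine_measurable R setT measurableT)).
    exact: measurable_int iS.
  by move=> x _; rewrite /= -/(S x); case: (S x) => //=; rewrite leey.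
have aeS : {ae mu, forall x, S x \is a fin_num}.
  have aeF : Filter (almost_everywhere mu) := ae_filter_ringOfSetsType mu.
  by apply: filterS (integrable_ae measurableT iS) => x; exact.
have iut := integrable_shift (t *: e) iu.
pose W x := u (x + t *: e) - u x - fine (S x).
have iW : mu.-integrable setT (EFin \o W).
  have := integrableB measurableT (integrableB measurableT iut iu) ifS.
  exact: eq_integrable.
have W0 : {ae mu, forall x, W x = 0}.
  apply: fundamental_lemma => // phi tphi.
  have [B HB] := test_bounded tphi; have mphi := test_measurable tphi.
  have i1 := integrable_mul_bounded iut mphi HB.
  have i2 := integrable_mul_bounded iu mphi HB.
  have i3 := integrable_mul_bounded ifS mphi HB.
  rewrite (_ : (fun x => _) = (fun x => (u (x + t *: e) * phi x)%:E - (u x * phi x)%:E -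
      (fine (S x) * phi x)%:E)%E); last first.
    by apply/funext => x; rewrite -!EFinB /W !mulrBl.
  rewrite integralB//; last exact: integrableB.
  rewrite integralB//.
  have -> : (\int[mu]_x (u (x + t *: e)%R * phi x)%:E = (line_corr i u phi t)%:E)%E.
    rewrite line_corrE// -(integral_shift (t *: e) (f := fun x => (u x * phi (x - t *: e)%R)%:E)).
      by apply: eq_integral => x _; rewrite addrK.
    by apply: measurable_int; exact: integrable_mul_test.
  have -> : (\int[mu]_x (u x * phi x)%:E = (line_corr i u phi 0)%:E)%E.
    by rewrite line_corrE//; apply: eq_integral => x _; rewrite scale0r subr0.
  have -> : (\int[mu]_x (fine (S x) * phi x)%:E = \int[mu]_x ((phi x)%:E * S x))%E.
    apply: ae_eq_integral => //.
    - exact: measurable_int i3.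
    - apply: emeasurable_funM; first exact/measurable_EFinP.
      exact: measurable_int iS.
    - have aeF : Filter (almost_everywhere mu) := ae_filter_ringOfSetsType mu.
      by apply: filterS aeS => x Sx _; rewrite EFinM fineK// muleC.
  have [_ _ ->] := line_fubini e t iv mphi HB.
  rewrite -(line_corr_FTC iu iv tphi _ t0); last first.
    by move=> s; exact: weak_partial_line_corr.
  have -> : (\int[leb]_(s in `[0%R, t]) \int[mu]_x (v x * phi (x - (s : R) *: e)%R)%:E =
      \int[leb]_(s in `[0%R, t]) (line_corr i v phi s)%:E)%E.
    by apply: eq_integral => s _; rewrite line_corrE.
  rewrite subee// (line_corr_FTC iu iv tphi _ t0)//.
  by move=> s; exact: weak_partial_line_corr.
have aeF : Filter (almost_everywhere mu) := ae_filter_ringOfSetsType mu.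
apply: filterS2 W0 aeS => x /eqP; rewrite subr_eq0 => /eqP -> Sx.
by rewrite fineK.
Qed.

End sobolev_translation.

(** * The upper gradient inequality for the maximal function *)

Section line_shift.
Context {R : realType}.
Local Notation leb := (@lebesgue_measure R).

Lemma lebesgue_measure_shift (z : R) (A : set R) : measurable A ->
  leb ((fun s : R => s + z) @^-1` A) = leb A.
Proof.
move=> mA.
have ms : measurable_fun setT (fun s : R => s + z) by exact: measurable_funD.
pose m := @measure_function_pushforward__canonical__measure_function_Measure
  _ _ (measurableTypeR R) (measurableTypeR R) R leb (fun s : R => s + z) ms.
suff H : forall X, ocitv X -> leb X = m X.
  by apply/esym; exact: (lebesgue_measure_unique H mA).
move=> _ [[a b] _ <-]/=; rewrite /m/= /pushforward (_ : _ @^-1` _ = `]a - z, b - z]%classic); last first.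
  by apply/seteqP; split => s /=; rewrite !in_itv/= ltrBlDr lerBrDr.
have := lebesgue_measure_itv `]a - z, b - z]; have := lebesgue_measure_itv `]a, b].
rewrite /= => -> ->; rewrite !lte_fin ltrD2r; case: ifP => // _.
by rewrite -!EFinB; congr EFin; ring.
Qed.

Lemma ge0_integral_line_shift (z a b : R) (f : R -> \bar R) :
  measurable_fun setT f -> (forall s, (0 <= f s)%E) ->
  (\int[leb]_(s in `[a, b]) f (s + z)%R = \int[leb]_(s in `[(a + z)%R, (b + z)%R]) f s)%E.
Proof.
move=> mf f0.
have ms : measurable_fun setT (fun s : R => s + z) by exact: measurable_funD.
pose m := @measure_function_pushforward__canonical__measure_function_Measure
  _ _ (measurableTypeR R) (measurableTypeR R) R leb (fun s : R => s + z) ms.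
rewrite -[RHS](@eq_measure_integral _ _ _ _ leb m); last first.
  by move=> A mA _; exact: lebesgue_measure_shift.
rewrite [RHS]ge0_integral_pushforward//; last exact: measurable_funTS.
by congr integral; apply/seteqP; split => s /=; rewrite !in_itv/= !lerD2r.
Qed.
End line_shift.

Section upper_gradient.
Context {R : realType} {n : nat} (i : 'I_n).
Local Notation mu := (lebesgue_rV R n).
Local Notation leb := (@lebesgue_measure R).
Local Notation e := (delta_mx 0 i : 'rV[R]_n).

Lemma line_tonelli (f : 'rV[R]_n -> \bar R) (D : set 'rV[R]_n) (t : R) :
  measurable D -> measurable_fun setT f -> (forall x, (0 <= f x)%E) ->
  measurable_fun setT (fun s : R => \int[mu]_(x in D) f (x + s *: e)%R)%E /\
  (\int[mu]_(x in D) \int[leb]_(s in `[0%R, t]) f (x + (s : R) *: e)%R =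
   \int[leb]_(s in `[0%R, t]) \int[mu]_(x in D) f (x + (s : R) *: e)%R)%E.
Proof.
move=> mD mf f0.
pose F0 (p : 'rV[R]_n * measurableTypeR R) : \bar R :=
  (f (p.1 + (p.2 : R) *: e)%R * (\1_D p.1)%:E)%E.
pose F (p : 'rV[R]_n * measurableTypeR R) : \bar R :=
  (F0 p * (\1_(`[0%R, t]%classic : set R) (p.2 : R))%:E)%E.
have mF0 : measurable_fun setT F0.
  apply: emeasurable_funM.
    by apply: (measurableT_comp mf); exact: measurable_line.
  apply/measurable_EFinP; apply: measurableT_comp; last exact: measurable_fst.
  exact: measurable_indic.
have mF : measurable_fun setT F.
  apply: emeasurable_funM => //.
  apply/measurable_EFinP; apply: measurableT_comp; last exact: measurable_snd.
  exact: measurable_indic.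
have F0_ge0 p : (0 <= F0 p)%E by rewrite /F0 mule_ge0// lee_fin.
have F_ge0 p : (0 <= F p)%E by rewrite /F mule_ge0// lee_fin.
have F0E s : (\int[mu]_x F0 (x, s) = \int[mu]_(x in D) f (x + (s : R) *: e)%R)%E.
  rewrite [RHS]integral_mkcond; apply: eq_integral => x _.
  by rewrite patchE /F0/= indicE; case: ifP => _; rewrite (mule1, mule0).
split.
  have := measurable_fun_fubini_tonelli_G (m1 := mu) F0 mF0 F0_ge0.
  by rewrite /fubini_G; under eq_fun do rewrite F0E.
transitivity (\int[mu]_x \int[leb]_s F (x, s))%E.
  rewrite integral_mkcond; apply: eq_integral => x _; rewrite patchE.
  case: ifPn => xD; last first.
    by rewrite (eq_integral (cst 0%E)) ?integral0// => s _; rewrite /F /F0 indicE/= (negbTE xD) mule0 mul0e.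
  rewrite [LHS]integral_mkcond; apply: eq_integral => s _.
  by rewrite patchE /F /F0/= !indicE xD mule1; case: ifP => _; rewrite (mule1, mule0).
rewrite (fubini_tonelli _ mF)// [RHS]integral_mkcond; apply: eq_integral => s _.
rewrite patchE -F0E /F/= indicE; case: ifPn => _.
  by under eq_integral do rewrite mule1.
by under eq_integral do rewrite mule0; rewrite integral0.
Qed.

Lemma measurable_line_integral (f : 'rV[R]_n -> \bar R) (t : R) :
  measurable_fun setT f -> (forall x, (0 <= f x)%E) ->
  measurable_fun setT
    (fun x : 'rV[R]_n => \int[leb]_(s in `[0%R, t]) f (x + (s : R) *: e)%R)%E.
Proof.
move=> mf f0.
pose F (p : 'rV[R]_n * measurableTypeR R) : \bar R :=
  (f (p.1 + (p.2 : R) *: e)%R * (\1_(`[0%R, t]%classic : set R) (p.2 : R))%:E)%E.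
have mF : measurable_fun setT F.
  apply: emeasurable_funM.
    by apply: (measurableT_comp mf); exact: measurable_line.
  apply/measurable_EFinP; apply: measurableT_comp; last exact: measurable_snd.
  exact: measurable_indic.
have F_ge0 p : (0 <= F p)%E by rewrite /F mule_ge0// lee_fin.
have FE x : (\int[leb]_s F (x, s) = \int[leb]_(s in `[0%R, t]) f (x + (s : R) *: e)%R)%E.
  rewrite [RHS]integral_mkcond; apply: eq_integral => s _.
  by rewrite patchE /F/= indicE; case: ifP => _; rewrite (mule1, mule0).
have := measurable_fun_fubini_tonelli_F (m2 := leb) F mF F_ge0.
by rewrite /fubini_F; under eq_fun do rewrite FE.
Qed.

End upper_gradient.

Section euclidean_norm.
Context {R : realType} {n : nat}.
Implicit Types v : 'rV[R]_n.

Lemma enorm_ge0 v : 0 <= enorm v. Proof. exact: sqrtr_ge0. Qed.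

Lemma enorm_coord v i : `|v 0 i| <= enorm v.
Proof.
rewrite -sqrtr_sqr ler_sqrt ?sumr_ge0// => [|j _]; last exact: sqr_ge0.
by rewrite (bigD1 i)//= lerDl sumr_ge0// => j _; exact: sqr_ge0.
Qed.

Lemma enorm_le_sum v : enorm v <= \sum_i `|v 0 i|.
Proof.
have S0 : 0 <= \sum_i `|v 0 i| by exact: sumr_ge0.
rewrite -[leRHS]ger0_norm// -sqrtr_sqr ler_sqrt ?sqr_ge0//.
rewrite [leRHS]expr2 mulr_suml; apply: ler_sum => i _.
rewrite -real_normK ?num_real// expr2 ler_wpM2l//.
by rewrite (bigD1 i)//= lerDl sumr_ge0.
Qed.

Lemma measurable_enorm d (T : measurableType d) (f : T -> 'rV[R]_n) :
  (forall i, measurable_fun setT (fun x => f x 0 i)) ->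
  measurable_fun setT (fun x => enorm (f x)).
Proof.
move=> mf; apply: (measurableT_comp (f := @Num.sqrt R)).
  by apply: continuous_measurable_fun; exact: sqrt_continuous.
by apply: measurable_sum => i; exact: measurable_funX.
Qed.

End euclidean_norm.

Lemma cube_avg_shift (R : realType) (n : nat) (f : 'rV[R]_n -> R) c r z :
  measurable_fun setT f -> 0 < r ->
  (cube_avg f (cube (c + z) r) = (((2 * r) ^+ n)^-1)%:E *
    \int[lebesgue_rV R n]_(x in cube c r) `|f (x + z)%R|%:E)%E.
Proof.
move=> mf r0; rewrite cube_avgE//; congr (_ * _)%E.
rewrite -(@ge0_integral_shift_set _ _ z (fun y => `|f y|%:E))//.
- by rewrite cube_shift.
- exact: measurable_cube.
- by apply/measurable_EFinP; exact: measurableT_comp.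
Qed.

Section maximal_upper_gradient.
Context {R : realType} {n : nat} (i : 'I_n).
Local Notation mu := (lebesgue_rV R n).
Local Notation leb := (@lebesgue_measure R).
Local Notation e := (delta_mx 0 i : 'rV[R]_n).
Variables (u v N : 'rV[R]_n -> R).
Hypotheses (iu : mu.-integrable setT (EFin \o u))
  (iv : mu.-integrable setT (EFin \o v))
  (uv : weak_partial_off set0 i (EFin \o u) v)
  (mN : measurable_fun setT N) (vN : forall x, `|v x| <= N x).

Let N0 x : 0 <= N x. Proof. by rewrite (le_trans _ (vN x)). Qed.
Let mu_ : measurable_fun setT u. Proof. by apply/measurable_EFinP; case/integrableP : iu. Qed.
Let mv : measurable_fun setT v. Proof. by apply/measurable_EFinP; case/integrableP : iv. Qed.
Let mEN : measurable_fun setT (EFin \o N). Proof. exact/measurable_EFinP. Qed.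
Let aeF : Filter (almost_everywhere mu) := ae_filter_ringOfSetsType mu.

Let S (t : R) x := (\int[leb]_(s in `[0%R, t]) (N (x + (s : R) *: e)%R)%:E)%E.

Let mline (f : 'rV[R]_n -> R) x : measurable_fun setT f ->
  measurable_fun setT (fun s : R => f (x + s *: e)).
Proof. by move=> mf; apply: (measurableT_comp mf); exact: measurable_line_at. Qed.

Let mS t : measurable_fun setT (S t).
Proof. by apply: (measurable_line_integral i t mEN) => x; rewrite lee_fin. Qed.

Let S0 t x : (0 <= S t x)%E.
Proof. by apply: integral_ge0 => s _; rewrite lee_fin. Qed.

(** The majorant [N] replaces [|v|] so that the norm of the whole gradient can later serve for every
    direction. *)
Lemma translate_diff_le (t : R) : 0 < t ->
  {ae mu, forall x, (`|u (x + t *: e) - u x|%:E <= S t x)%E}.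
Proof.
move=> t0; apply: filterS (sobolev_translation iu iv uv t0) => x H.
rewrite -abse_EFin H; apply: le_trans (le_abse_integral _ _ _) _ => //.
  by apply: measurable_funTS; apply/measurable_EFinP; exact: mline.
apply: ge0_le_integral => //.
- by apply: measurable_funTS; apply: measurableT_comp => //; apply/measurable_EFinP; exact: mline.
- by apply: measurable_funTS; apply/measurable_EFinP; exact: mline.
- by move=> s _; rewrite lee_fin.
Qed.

(** Two additive inequalities take the place of a bound on an absolute difference, which would be
    awkward for infinite values. *)
Lemma translate_integral_le (t : R) (D : set 'rV[R]_n) : measurable D -> 0 < t ->
  (\int[mu]_(x in D) `|u (x + t *: e)|%:E <=
     \int[mu]_(x in D) `|u x|%:E +
     \int[leb]_(s in `[0%R, t]) \int[mu]_(x in D) (N (x + (s : R) *: e)%R)%:E)%E /\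
  (\int[mu]_(x in D) `|u x|%:E <=
     \int[mu]_(x in D) `|u (x + t *: e)|%:E +
     \int[leb]_(s in `[0%R, t]) \int[mu]_(x in D) (N (x + (s : R) *: e)%R)%:E)%E.
Proof.
move=> mD t0.
have [_ <-] := line_tonelli i t mD mEN (fun x => ltac:(by rewrite lee_fin)).
have mut : measurable_fun setT (fun x : 'rV[R]_n => u (x + t *: e)).
  by apply: (measurableT_comp mu_); exact: measurable_shift.
have m1 : measurable_fun D (fun x => `|u x|%:E).
  by apply: measurable_funTS; apply/measurable_EFinP; exact: measurableT_comp.
have m2 : measurable_fun D (fun x : 'rV[R]_n => `|u (x + t *: e)|%:E).
  by apply: measurable_funTS; apply/measurable_EFinP; exact: measurableT_comp.
have mSD : measurable_fun D (S t) by exact: measurable_funTS.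
have H := translate_diff_le t0.
have add (f : 'rV[R]_n -> R) : measurable_fun D (fun x => `|f x|%:E) ->
    (\int[mu]_(x in D) `|f x|%:E + \int[mu]_(x in D) S t x =
     \int[mu]_(x in D) (`|f x|%:E + S t x))%E.
  by move=> mf; apply/esym; apply: ge0_integralD.
rewrite (add _ m1) (add _ m2); split; apply: ae_ge0_le_integral => //.
- by move=> x _; apply: adde_ge0; [rewrite lee_fin|exact: (S0 t)].
- exact: emeasurable_funD.
- apply: filterS H => x Hx _; apply: le_trans (leeD2l _ Hx).
  rewrite -EFinD lee_fin -[X in `|X| <= _](subrKC (u x)); exact: ler_normD.
- by move=> x _; apply: adde_ge0; [rewrite lee_fin|exact: (S0 t)].
- exact: emeasurable_funD.
- apply: filterS H => x Hx _; apply: le_trans (leeD2l _ Hx).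
  rewrite -EFinD lee_fin distrC -[X in `|X| <= _](subrKC (u (x + t *: e))); exact: ler_normD.
Qed.

(** Averaging over a translated cube is averaging the translated function, and Tonelli turns the
    average of line integrals into a line integral of averages. The exceptional null set is absorbed
    by the integrals. *)
Lemma cube_avg_translate c (r t : R) : 0 < r -> 0 < t ->
  (cube_avg u (cube (c + t *: e) r) <= cube_avg u (cube c r) +
     \int[leb]_(s in `[0%R, t]) cube_avg N (cube (c + (s : R) *: e)%R r))%E /\
  (cube_avg u (cube c r) <= cube_avg u (cube (c + t *: e) r) +
     \int[leb]_(s in `[0%R, t]) cube_avg N (cube (c + (s : R) *: e)%R r))%E.
Proof.
move=> r0 t0; pose K := ((2 * r) ^+ n)^-1.
have K0 : 0 < K by rewrite invr_gt0 exprn_gt0// mulr_gt0.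
have avgE := fun f s mf => @cube_avg_shift R n f c r (s *: e) mf r0.
have mcN : measurable_fun setT
    (fun s : R => \int[mu]_(x in cube c r) (N (x + s *: e)%R)%:E)%E.
  by have [] := line_tonelli i t (measurable_cube c r) mEN (fun x => ltac:(by rewrite lee_fin)).
have -> : (\int[leb]_(s in `[0%R, t]) cube_avg N (cube (c + (s : R) *: e)%R r) =
    K%:E * \int[leb]_(s in `[0%R, t]) \int[mu]_(x in cube c r) (N (x + (s : R) *: e)%R)%:E)%E.
  rewrite -ge0_integralZl//; last 3 first.
  - exact: measurable_funTS.
  - by move=> s _; apply: integral_ge0 => x _; rewrite lee_fin.
  - by rewrite lee_fin ltW.
  apply: eq_integral => s _; rewrite avgE//; congr (_ * _)%E.
  by apply: eq_integral => x _; rewrite ger0_norm.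
have [A B] := translate_integral_le (measurable_cube c r) t0.
rewrite avgE// cube_avgE// -/K -!ge0_muleDr//; last 4 first.
- by apply: integral_ge0 => x _; rewrite lee_fin.
- by apply: integral_ge0 => s _; apply: integral_ge0 => x _; rewrite lee_fin.
- by apply: integral_ge0 => x _; rewrite lee_fin.
- by apply: integral_ge0 => s _; apply: integral_ge0 => x _; rewrite lee_fin.
by rewrite !lee_pmul2l.
Qed.

Lemma measurable_cube_avg_line c (r : R) : 0 < r ->
  measurable_fun setT (fun s : R => cube_avg N (cube (c + s *: e) r)).
Proof.
move=> r0; under eq_fun do rewrite cube_avg_shift//.
apply: emeasurable_funM; first exact: measurable_cst.
have [+ _] := line_tonelli i 0 (measurable_cube c r) mEN (fun x => ltac:(by rewrite lee_fin)).
apply: eq_measurable_fun => s _; apply: eq_integral => x _.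
by rewrite /= ger0_norm.
Qed.

(** This treats both maximal operators at once: what is used of the competing cubes is that they
    follow the point under translation and that the maximal function is the supremum of their
    averages. *)
Definition admissible (b : bool) (c : 'rV[R]_n) (r : R) x :=
  if b then c = x else cube c r x.

Lemma admissible_shift b c r x z : admissible b c r x -> admissible b (c + z) r (x + z).
Proof.
case: b => /= [->//|cx].
by have := cube_shift z c r; move=> /seteqP[_ /(_ x cx)].
Qed.

Lemma HL_ge b f c r x : 0 < r -> admissible b c r x ->
  (cube_avg f (cube c r) <= HL b f x)%E.
Proof.
by case: b => /= r0 => [->|cx]; [exact: HL_centred_ge|exact: HL_noncentred_ge].
Qed.

Lemma HL_le b f x M :
  (forall c r, 0 < r -> admissible b c r x -> (cube_avg f (cube c r) <= M)%E) ->
  (HL b f x <= M)%E.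
Proof.
case: b => H; first by apply: ge_ereal_sup => _ [r/= r0 <-]; exact: H.
by apply: ge_ereal_sup => _ [[c r]/= [r0 cx] <-]; exact: H.
Qed.

(** Translating a competing cube along the segment yields a competing cube at each of its points, so
    the averages of [N] under the integral are at most [HL b N] there. For the first inequality the
    cube at the far end is translated back to [x]. *)
Lemma HL_translate b x (t : R) : 0 < t ->
  (HL b u (x + t *: e) <= HL b u x +
    \int[leb]_(s in `[0%R, t]) HL b N (x + (s : R) *: e)%R)%E /\
  (HL b u x <= HL b u (x + t *: e) +
    \int[leb]_(s in `[0%R, t]) HL b N (x + (s : R) *: e)%R)%E.
Proof.
move=> t0.
have avgI c r : 0 < r -> admissible b c r x ->
    (\int[leb]_(s in `[0%R, t]) cube_avg N (cube (c + (s : R) *: e)%R r) <=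
     \int[leb]_(s in `[0%R, t]) HL b N (x + (s : R) *: e)%R)%E.
  move=> r0 cx; apply: ge0_le_integral => //.
  - by move=> s _; exact: cube_avg_ge0.
  - by apply: measurable_funTS; exact: measurable_cube_avg_line.
  - apply: measurable_funTS; apply: (measurableT_comp (measurable_HL b mN)).
    exact: measurable_line_at.
  - by move=> s _; apply: HL_ge => //; exact: admissible_shift.
split; apply: HL_le => c r r0 cx.
  have cx' : admissible b (c - t *: e) r x.
    by have := admissible_shift (- (t *: e)) cx; rewrite addrK.
  have [+ _] := cube_avg_translate (c - t *: e) r0 t0; rewrite subrK => /le_trans; apply.
  by apply: leeD; [exact: HL_ge|exact: avgI].
have [_ /le_trans] := cube_avg_translate c r0 t0; apply.
by apply: leeD; [apply: HL_ge => //; exact: admissible_shift|exact: avgI].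
Qed.

Lemma HL_line b x (s t : R) : s <= t ->
  (HL b u (x + t *: e) <= HL b u (x + s *: e) +
    \int[leb]_(r in `[s, t]) HL b N (x + (r : R) *: e)%R)%E /\
  (HL b u (x + s *: e) <= HL b u (x + t *: e) +
    \int[leb]_(r in `[s, t]) HL b N (x + (r : R) *: e)%R)%E.
Proof.
have g0 y : (0 <= HL b N y)%E by exact: HL_ge0.
rewrite le_eqVlt => /predU1P[<-|st].
  by split; apply: leeDl; apply: integral_ge0.
have ts : 0 < t - s by rewrite subr_gt0.
have := HL_translate b (x + s *: e) ts.
rewrite -addrA -scalerDl subrKC.
suff -> : (\int[leb]_(r in `[0%R, (t - s)%R]) HL b N (x + s *: e + (r : R) *: e)%R =
    \int[leb]_(r in `[s, t]) HL b N (x + (r : R) *: e)%R)%E by [].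
have -> : (\int[leb]_(r in `[s, t]) HL b N (x + (r : R) *: e)%R =
    \int[leb]_(r in `[(0 + s)%R, (t - s + s)%R]) HL b N (x + (r : R) *: e)%R)%E.
  by rewrite add0r subrK.
have mg : measurable_fun setT (fun r : R => HL b N (x + r *: e)).
  by apply: (measurableT_comp (measurable_HL b mN)); exact: measurable_line_at.
etransitivity; last exact: (ge0_integral_line_shift s 0 (t - s) mg (fun r => g0 _)).
by apply: eq_integral => r _; rewrite -addrA -scalerDl (addrC s).
Qed.

End maximal_upper_gradient.

(** * Local integrability of the maximal function *)

Section line_shift_full.
Context {R : realType}.
Local Notation leb := (@lebesgue_measure R).

Lemma ge0_integral_real_shift (z : R) (f : R -> \bar R) :
  measurable_fun setT f -> (forall s, (0 <= f s)%E) ->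
  (\int[leb]_s f (z + s)%R = \int[leb]_s f s)%E.
Proof.
move=> mf f0.
have ms : measurable_fun setT (fun s : R => s + z) by exact: measurable_funD.
pose m := @measure_function_pushforward__canonical__measure_function_Measure
  _ _ (measurableTypeR R) (measurableTypeR R) R leb (fun s : R => s + z) ms.
rewrite -[RHS](@eq_measure_integral _ _ _ _ leb m); last first.
  by move=> A mA _; exact: lebesgue_measure_shift.
rewrite [RHS]ge0_integral_pushforward//.
by apply: eq_integral => s _; rewrite /= addrC.
Qed.

Lemma ae_exists_itv (a b : R) (P : R -> Prop) : a < b -> {ae leb, forall x, P x} ->
  exists2 t, a < t < b & P t.
Proof.
move=> ab [N [mN N0 NP]]; apply: contrapT => H.
have abN : `]a, b[%classic `<=` N.
  move=> t; rewrite /= in_itv/= => tab; apply: NP => Pt; apply: H; by exists t.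
have : (leb `]a, b[%classic <= leb N)%E by rewrite le_measure ?inE.
have := lebesgue_measure_itv `]a, b[; rewrite /= lte_fin ab => ->.
by rewrite N0 -EFinB lee_fin subr_le0 leNgt ab.
Qed.

End line_shift_full.

Section local_integrability.
Context {R : realType}.
Local Notation leb := (@lebesgue_measure R).

Lemma ge0_integral_rV_cons n (f : 'rV[R]_n.+1 -> \bar R) :
  measurable_fun setT f -> (forall x, (0 <= f x)%E) ->
  (\int[lebesgue_rV R n.+1]_x f x =
   \int[leb]_t \int[lebesgue_rV R n]_y f (rV_cons (t, y)))%E.
Proof.
move=> mf f0.
transitivity (\int[pushforward (leb \x lebesgue_rV R n)%E (@rV_cons R n)]_x f x)%E.
  by [].
rewrite (ge0_integral_pushforward (@measurable_rV_cons R n))//.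
rewrite preimage_setT fubini_tonelli1//; last by move=> p; exact: f0.
by apply: (measurableT_comp mf); exact: measurable_rV_cons.
Qed.

Lemma measurable_rV_cons_r n (t : R) : measurable_fun setT (fun y : 'rV[R]_n => rV_cons (t, y)).
Proof.
by apply: (measurableT_comp (@measurable_rV_cons R n)); exact: measurable_pair1.
Qed.

Lemma ae_rV_cons n (P : 'rV[R]_n.+1 -> Prop) : {ae lebesgue_rV R n.+1, forall x, P x} ->
  {ae leb, forall t, {ae lebesgue_rV R n, forall y, P (rV_cons (t, y))}}.
Proof.
move=> [N [mN N0 NP]].
have mI : measurable_fun setT (fun x => (\1_N x)%:E : \bar R).
  by apply/measurable_EFinP; exact: measurable_indic.
have I0 x : (0 <= (\1_N x)%:E :> \bar R)%E by rewrite lee_fin.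
have mF := measurable_fun_fubini_tonelli_F (m2 := lebesgue_rV R n)
  (fun p => (\1_N (rV_cons p))%:E) (measurableT_comp mI (@measurable_rV_cons R n))
  (fun p => I0 (rV_cons p)).
have H : (\int[leb]_t `|\int[lebesgue_rV R n]_y (\1_N (rV_cons (t, y)))%:E| = 0)%E.
  under eq_integral => t _ do (rewrite gee0_abs; last exact: integral_ge0).
  rewrite -(ge0_integral_rV_cons mI I0) integral_indic// setIT; exact: N0.
have aeF : Filter (almost_everywhere leb) := ae_filter_ringOfSetsType leb.
have := (ae_eq_integral_abs leb measurableT mF).1 H.
apply: filterS => t /(_ I) Ht.
exists ((fun y => rV_cons (t, y)) @^-1` N); split.
- by rewrite -[X in measurable X]setTI; exact: measurable_rV_cons_r.
- rewrite -[RHS]Ht /fubini_F.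
  transitivity (\int[lebesgue_rV R n]_y (\1_((fun y => rV_cons (t, y)) @^-1` N) y)%:E)%E => //.
  rewrite integral_indic ?setIT//.
  by rewrite -[X in measurable X]setTI; exact: measurable_rV_cons_r.
- by move=> y /= Py; apply: NP.
Qed.

Lemma rV_cons_shift0 n (s r : R) (y : 'rV[R]_n) :
  rV_cons (s, y) + r *: delta_mx 0 ord0 = rV_cons (s + r, y).
Proof.
apply/rowP => j; rewrite !mxE eqxx/=; case: unliftP => [k ->|->].
  by rewrite eq_sym (negbTE (neq_lift _ _)) mulr0 addr0.
by rewrite eqxx mulr1.
Qed.

Lemma rV_cons_shift n (s r : R) (y : 'rV[R]_n) (j : 'I_n) :
  rV_cons (s, y) + r *: delta_mx 0 (lift ord0 j) = rV_cons (s, y + r *: delta_mx 0 j).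
Proof.
apply/rowP => k; rewrite !mxE eqxx/=; case: unliftP => [l ->|->].
  by rewrite !mxE eqxx/= (inj_eq lift_inj).
by rewrite (negbTE (neq_lift _ _)) mulr0 addr0.
Qed.

(* Induction on the dimension: some slice of the box, orthogonal to the first
   axis, has finite integrals of v (by induction) and g, and v is compared on
   every other slice with its values on that one. *)
Lemma upper_gradient_box n (a b : 'rV[R]_n) (v g : 'rV[R]_n -> \bar R) :
  measurable_fun setT v -> measurable_fun setT g ->
  (forall x, (0 <= v x)%E) -> (forall x, (0 <= g x)%E) ->
  (\int[lebesgue_rV R n]_x g x < +oo)%E ->
  {ae lebesgue_rV R n, forall x, box a b x -> (v x < +oo)%E} ->
  (forall j x t, box a b x -> box a b (x + t *: delta_mx 0 j) ->
    (v x <= v (x + t *: delta_mx 0 j)%R +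
       \int[leb]_s g (x + (s : R) *: delta_mx 0 j)%R)%E) ->
  (\int[lebesgue_rV R n]_(x in box a b) v x < +oo)%E.
Proof.
elim: n a b v g => [|n IH] a b v g mv mg v0 g0 goo vae vg.
  (* In dimension 0 the measure is a unit mass at a single point, so finiteness almost everywhere is
     finiteness there. *)
  have boxT : box a b = setT by rewrite -subTset => x _ [].
  rewrite boxT/= integral_dirac// diracT mul1e.
  case: vae => N [mN N0 NP]; rewrite ltNge; apply/negP => voo.
  have /NP N00 : (~` [set x | box a b x -> (v x < +oo)%E]) (0 : 'rV[R]_0).
    by rewrite boxT => /(_ I); rewrite ltNge voo.
  by move: N0; rewrite /= diracE mem_set// => -[] /eqP; rewrite oner_eq0.
have [ab0|ab0] := leP (b 0 ord0) (a 0 ord0).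
  rewrite (_ : box a b = set0) ?integral_set0// -subset0 => x /(_ ord0) /andP[ax xb].
  by have := lt_trans ax xb; rewrite ltNge ab0.
pose a' : 'rV[R]_n := \row_i a 0 (lift ord0 i).
pose b' : 'rV[R]_n := \row_i b 0 (lift ord0 i).
have boxE t y : box a b (rV_cons (t, y)) <-> (a 0 ord0 < t < b 0 ord0) /\ box a' b' y.
  split=> [H|[tab H] j].
    split; first by have := H ord0; rewrite !mxE unlift_none.
    by move=> i; have := H (lift ord0 i); rewrite !mxE liftK.
  by rewrite mxE; case: unliftP => [k ->|->//]; have := H k; rewrite !mxE.
have mgc : measurable_fun setT (fun p : measurableTypeR R * 'rV[R]_n => g (rV_cons p)).
  by apply: (measurableT_comp mg); exact: measurable_rV_cons.
have mvc : measurable_fun setT (fun p : measurableTypeR R * 'rV[R]_n => v (rV_cons p)).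
  by apply: (measurableT_comp mv); exact: measurable_rV_cons.
have mgt t : measurable_fun setT (fun y : 'rV[R]_n => g (rV_cons (t, y))).
  by apply: (measurableT_comp mg); exact: measurable_rV_cons_r.
have mvt t : measurable_fun setT (fun y : 'rV[R]_n => v (rV_cons (t, y))).
  by apply: (measurableT_comp mv); exact: measurable_rV_cons_r.
have mgy (y : 'rV[R]_n) : measurable_fun setT (fun t : R => g (rV_cons (t, y))).
  by apply: (measurableT_comp mgc); exact: measurable_pair2.
have gE := ge0_integral_rV_cons mg g0.
have aeg : {ae leb, forall t, (\int[lebesgue_rV R n]_y g (rV_cons (t, y)) < +oo)%E}.
  have iF : leb.-integrable setT (fun t => \int[lebesgue_rV R n]_y g (rV_cons (t, y)))%E.
    apply/integrableP; split; first exact: (measurable_fun_fubini_tonelli_F _ mgc).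
    under eq_integral => t _ do (rewrite gee0_abs; last exact: integral_ge0).
    by rewrite -gE.
  have aeF : Filter (almost_everywhere leb) := ae_filter_ringOfSetsType leb.
  apply: filterS (integrable_ae measurableT iF) => t /(_ I).
  by rewrite ge0_fin_numE//; exact: integral_ge0.
have aev := ae_rV_cons vae.
have [t tab [gt vt]] : exists2 t, a 0 ord0 < t < b 0 ord0 &
    (\int[lebesgue_rV R n]_y g (rV_cons (t, y)) < +oo)%E /\
    {ae lebesgue_rV R n, forall y, box a b (rV_cons (t, y)) -> (v (rV_cons (t, y)) < +oo)%E}.
  apply: ae_exists_itv => //.
  have aeF : Filter (almost_everywhere leb) := ae_filter_ringOfSetsType leb.
  by apply: filterS2 aeg aev => t.
pose A := (\int[lebesgue_rV R n]_(y in box a' b') v (rV_cons (t, y)))%E.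
have Aoo : (A < +oo)%E.
  apply: (IH a' b' _ (fun y => g (rV_cons (t, y)))) => //.
    have aeF : Filter (almost_everywhere (lebesgue_rV R n)) := ae_filter_ringOfSetsType _.
    by apply: filterS vt => y H yb; apply: H; apply/boxE.
  move=> j y r yb yrb.
  have := vg (lift ord0 j) (rV_cons (t, y)) r; rewrite rV_cons_shift.
  under eq_integral do rewrite rV_cons_shift.
  by apply; apply/boxE.
(* The integral runs over the whole line and so does not depend on the slice:
   [v (s, y) <= v (t, y) + G y] bounds all slices by the same [B]. *)
pose G y := (\int[leb]_s g (rV_cons (s, y)))%E.
have mG : measurable_fun setT G.
  exact: (measurable_fun_fubini_tonelli_G (m1 := leb) _ mgc).
have G0 y : (0 <= G y)%E by exact: integral_ge0.
have GE : (\int[lebesgue_rV R n]_y G y = \int[lebesgue_rV R n.+1]_x g x)%E.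
  by rewrite gE (fubini_tonelli _ mgc).
pose B := (\int[lebesgue_rV R n]_(y in box a' b') (v (rV_cons (t, y)) + G y))%E.
have Boo : (B < +oo)%E.
  rewrite /B ge0_integralD//; [|exact: measurable_box|exact: measurable_funTS|exact: measurable_funTS].
  rewrite lte_add_pinfty//; apply: le_lt_trans goo; rewrite -GE.
  by apply: ge0_subset_integral => //; exact: measurable_box.
have B0 : (0 <= B)%E by apply: integral_ge0 => y _; exact: adde_ge0.
have main (s : R) : (\int[lebesgue_rV R n]_y (v \_ (box a b)) (rV_cons (s, y)) <=
    B * (\1_(`]a 0 ord0, b 0 ord0[%classic : set R) s)%:E)%E.
  rewrite indicE; case: (boolP (s \in _)) => sab.
    rewrite mule1 /B [leRHS]integral_mkcond; apply: ge0_le_integral => //.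
    - by move=> y _; rewrite patchE; case: ifP.
    - apply: (measurableT_comp (f := v \_ (box a b))); last exact: measurable_rV_cons_r.
      by apply/(measurable_restrictT _ _).1; [exact: measurable_box|exact: measurable_funTS].
    - apply/(measurable_restrictT _ _).1; first exact: measurable_box.
      by apply: measurable_funTS; exact: emeasurable_funD.
    - move=> y _; rewrite !patchE; case: ifPn => [|_]; last first.
        by case: ifP => // _; exact: adde_ge0.
      rewrite inE => /boxE[sab' yb]; rewrite mem_set//.
      have := vg ord0 (rV_cons (s, y)) (t - s); rewrite rV_cons_shift0 subrKC.
      have -> : (\int[leb]_r g (rV_cons (s, y) + (r : R) *: delta_mx 0 ord0)%R = G y)%E.
        under eq_integral do rewrite rV_cons_shift0.
        exact: (ge0_integral_real_shift s (mgy y)).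
      by apply; apply/boxE.
  rewrite mule0 (eq_integral (cst 0%E)) ?integral0// => y _.
  rewrite patchE ifF//; apply/negbTE; apply: contra sab.
  by rewrite !inE => /boxE[] sab' _; rewrite /= in_itv.
rewrite integral_mkcond ge0_integral_rV_cons; last 2 first.
- by apply/(measurable_restrictT _ _).1; [exact: measurable_box|exact: measurable_funTS].
- by move=> x; rewrite patchE; case: ifP.
apply: (@le_lt_trans _ _ (\int[leb]_s (B * (\1_(`]a 0 ord0, b 0 ord0[%classic : set R) s)%:E))%E).
  apply: ge0_le_integral => //.
  - move=> s _; apply: integral_ge0 => y _; rewrite patchE; case: ifP => // _; exact: v0.
  - apply: (measurable_fun_fubini_tonelli_F (m2 := lebesgue_rV R n) (fun p => (v \_ (box a b)) (rV_cons p))).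
      apply: (measurableT_comp (f := v \_ (box a b))); last exact: measurable_rV_cons.
      by apply/(measurable_restrictT _ _).1; [exact: measurable_box|exact: measurable_funTS].
    by move=> p; rewrite patchE; case: ifP.
  - apply: emeasurable_funM; first exact: measurable_cst.
    by apply/measurable_EFinP; exact: measurable_indic.
have mI : measurable_fun setT (fun s : R => (\1_(`]a 0 ord0, b 0 ord0[%classic : set R) s)%:E : \bar R).
  by apply/measurable_EFinP; exact: measurable_indic.
rewrite (ge0_integralZl leb measurableT mI)//.
rewrite integral_indic// setIT lte_mul_pinfty//; first by rewrite ge0_fin_numE.
have := lebesgue_measure_itv `]a 0 ord0, b 0 ord0[; rewrite /= lte_fin ab0 => ->.
by rewrite -EFinB ltry.
Qed.

End local_integrability.

(** * The weak derivative of the maximal function *)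

Section maximal_function_line.
Context {R : realType} {n : nat} (i : 'I_n) (b : bool).
Local Notation mu := (lebesgue_rV R n).
Local Notation leb := (@lebesgue_measure R).
Local Notation e := (delta_mx 0 i : 'rV[R]_n).
Variables (u v N : 'rV[R]_n -> R).
Hypotheses (iu : mu.-integrable setT (EFin \o u))
  (iv : mu.-integrable setT (EFin \o v))
  (uv : weak_partial_off set0 i (EFin \o u) v)
  (mN : measurable_fun setT N) (vN : forall x, `|v x| <= N x).

(** On a line in direction [i] this restricts to the [lim_quot] density of [upper_gradient_segment],
    with [HL b N] as the upper gradient. *)
Definition maximal_partial x : R :=
  lim_quot (fun k => k.+1%:R *
    (fine (HL b u (x + k.+1%:R^-1 *: e)) - fine (HL b u x))) (HL b N x).

Let mu_ : measurable_fun setT u. Proof. by apply/measurable_EFinP; case/integrableP : iu. Qed.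
Let mfu : measurable_fun setT (fun x => fine (HL b u x)).
Proof.
apply: (measurableT_comp (@fine_measurable R setT measurableT)); exact: measurable_HL.
Qed.

Lemma maximal_partial_le x : (`|maximal_partial x|%:E <= HL b N x)%E.
Proof. by apply: lim_quot_le; exact: HL_ge0. Qed.

Lemma measurable_maximal_partial : measurable_fun setT maximal_partial.
Proof.
apply: measurable_lim_quot; last exact: measurable_HL.
move=> k; apply: measurable_funM; first exact: measurable_cst.
apply: measurable_funB => //; apply: (measurableT_comp mfu); exact: measurable_shift.
Qed.

(** Finiteness at [x] propagates along the segment by [HL_line], so [fine] loses nothing there, and
    the extended inequalities become the upper gradient inequality for a real function. *)
Lemma maximal_line_AC x (rho t : R) : (HL b u x < +oo)%E ->
  (\int[leb]_(s in `[0%R, rho]) HL b N (x + (s : R) *: e)%R < +oo)%E ->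
  0 <= t -> t <= rho ->
  ((fine (HL b u (x + t *: e)) - fine (HL b u x))%:E =
   \int[leb]_(s in `[0%R, t]) (maximal_partial (x + (s : R) *: e)%R)%:E)%E.
Proof.
move=> vx goo t0 trho.
have rho0 : 0 <= rho by exact: le_trans trho.
have mg : measurable_fun setT (fun s : R => HL b N (x + s *: e)).
  apply: (measurableT_comp (measurable_HL b mN)); exact: measurable_line_at.
have mV : measurable_fun setT (fun s : R => fine (HL b u (x + s *: e))).
  by apply: (measurableT_comp mfu); exact: measurable_line_at.
have g0 s : (0 <= HL b N (x + s *: e))%E by exact: HL_ge0.
have sub_lty s s' : 0 <= s -> s' <= rho ->
    (\int[leb]_(r in `[s, s']) HL b N (x + (r : R) *: e)%R < +oo)%E.
  move=> s0 srho; apply: le_lt_trans goo; apply: ge0_subset_integral => //.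
    exact: measurable_funTS.
  by apply: subset_itv; rewrite bnd_simp.
have finV s : 0 <= s -> s <= rho -> HL b u (x + s *: e) \is a fin_num.
  move=> s0 srho; rewrite ge0_fin_numE ?HL_ge0//.
  have [+ _] := HL_line iu iv uv mN vN b x s0; rewrite scale0r addr0 => /le_lt_trans; apply.
  by rewrite lte_add_pinfty// sub_lty.
have VG s s' : 0 <= s -> s <= s' -> s' <= rho ->
    (`|fine (HL b u (x + s' *: e)) - fine (HL b u (x + s *: e))|%:E <=
     \int[leb]_(r in `]s, s']) HL b N (x + (r : R) *: e)%R)%E.
  move=> s0 ss' srho.
  have f1 := finV _ s0 (le_trans ss' srho); have f2 := finV _ (le_trans s0 ss') srho.
  rewrite (integral_itv_obnd_cbnd (f := fun r => HL b N (x + r *: e))); last exact: measurable_funTS.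
  have ifin : (\int[leb]_(r in `[s, s']) HL b N (x + (r : R) *: e)%R)%E \is a fin_num.
    by rewrite ge0_fin_numE ?sub_lty//; exact: integral_ge0.
  have := HL_line iu iv uv mN vN b x ss'.
  rewrite -(fineK f1) -(fineK f2) -(fineK ifin) -!EFinD !lee_fin /= => -[A B].
  by rewrite ler_norml; apply/andP; split; lra.
have := upper_gradient_segment mV mg g0 rho0 goo VG (lexx 0) t0 trho.
rewrite scale0r addr0 => ->.
rewrite (integral_itv_obnd_cbnd (f := fun s => (lim_quot _ (HL b N (x + s *: e)))%:E)).
  have E s : lim_quot (fun k => k.+1%:R * (fine (HL b u (x + (s + k.+1%:R^-1) *: e)) -
      fine (HL b u (x + s *: e)))) (HL b N (x + s *: e)) = maximal_partial (x + s *: e).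
    apply: (f_equal2 (@lim_quot R)) => //; apply/funext => k.
    by rewrite scalerDl addrA.
  by apply: eq_integral => s _; exact: (f_equal EFin (E s)).
apply: measurable_funTS; apply/measurable_EFinP; apply: measurable_lim_quot => // k.
apply: measurable_funM; first exact: measurable_cst.
apply: measurable_funB => //; apply: (measurableT_comp mfu).
apply: measurable_rV_add; first exact: measurable_cst.
by apply: measurable_rV_scale; exact: measurable_funD.
Qed.

End maximal_function_line.

Section local_maximal_function.
Context {R : realType} {n : nat}.
Local Notation mu := (lebesgue_rV R n).
Local Notation leb := (@lebesgue_measure R).
Implicit Types (x c : 'rV[R]_n).

Lemma integral_bigsetU_lty (f : 'rV[R]_n -> \bar R) (s : seq ('rV[R]_n * R)) :
  measurable_fun setT f -> (forall x, (0 <= f x)%E) ->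
  (forall p, p \in s -> (\int[mu]_(x in cube p.1 p.2) f x < +oo)%E) ->
  (\int[mu]_(x in \big[setU/set0]_(p <- s) cube p.1 p.2) f x < +oo)%E.
Proof.
move=> mf f0; have [m mE] := density_measure mu mf f0.
rewrite -mE.
elim: s => [_|p s IH H]; first by rewrite big_nil measure0.
have mp : (m (cube p.1 p.2) < +oo)%E by rewrite mE; apply: H; exact: mem_head.
have ms : (m (\big[setU/set0]_(q <- s) cube q.1 q.2) < +oo)%E.
  by apply: IH => q qs; apply: H; rewrite inE qs orbT.
rewrite big_cons; apply: le_lt_trans (lte_add_pinfty mp ms).
apply: measureU2; first exact: measurable_cube.
by apply: bigsetU_measurable => q _; exact: measurable_cube.
Qed.

(** Lebesgue number argument: the cubes with halved radii already cover [K], and [rho] is at most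
    each of the halved radii, so that moving by [rho] stays in the full cube. *)
Lemma compact_cube_cover (K : set 'rV[R]_n) (P : 'rV[R]_n -> R -> Prop) :
  compact K -> (forall x, K x -> exists2 r, 0 < r & P x r) ->
  exists (s : seq ('rV[R]_n * R)) (rho : R), [/\ 0 < rho,
    forall p, p \in s -> P p.1 p.2 &
    forall x (y : 'rV[R]_n), K x -> (forall j, `|y 0 j - x 0 j| <= rho) ->
      (\big[setU/set0]_(p <- s) cube p.1 p.2) y].
Proof.
rewrite compact_cover => cK KP.
have [|x Kx|D' D'P D'K] := cK _ [set p : 'rV[R]_n * R | 0 < p.2 /\ P p.1 p.2]
  (fun p => cube p.1 (p.2 / 2)).
- by move=> p _; exact: open_cube.
- have [r r0 Pr] := KP _ Kx; exists (x, r) => //=.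
  by apply: cube_center; rewrite divr_gt0.
pose s : seq ('rV[R]_n * R) := finmap.enum_fset D'.
have sP p : p \in s -> 0 < p.2 /\ P p.1 p.2 by move=> ps; have := D'P p ps; rewrite inE.
pose rho := \big[Num.min/1]_(p <- s) (p.2 / 2).
exists s, rho; split; [|by move=> p /sP[]|].
- rewrite /rho big_seq; apply: (big_ind (fun t => 0 < t)) => //.
    by move=> t t' t0 t'0; rewrite lt_min t0.
  by move=> p /sP[p0 _]; rewrite divr_gt0.
- move=> x y Kx xy; have [p ps px] := D'K _ Kx.
  rewrite -bigcup_seq; exists p => // j.
  have rp : rho <= p.2 / 2.
    have : p \in s by exact: ps.
    rewrite /rho; elim: (s) => // p' s0 IH.
    by rewrite big_cons inE ge_min => /predU1P[->|/IH->]; rewrite ?lexx ?orbT.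
  have := px j; have := xy j; rewrite ler_norml => /andP[h1 h2] /andP[h3 h4].
  by apply/andP; split; lra.
Qed.

End local_maximal_function.

Lemma line_corr0E (R : realType) (n : nat) (i : 'I_n) (w phi : 'rV[R]_n -> R) :
  (lebesgue_rV R n).-integrable setT (EFin \o w) -> test_function phi ->
  ((line_corr i w phi 0)%:E = \int[lebesgue_rV R n]_x (w x * phi x)%:E)%E.
Proof.
move=> iw tphi; etransitivity; first exact: (line_corrE i 0 iw tphi).
by apply: eq_integral => x _; rewrite scale0r subr0.
Qed.

Section weak_derivative_of_maximal_function.
Context {R : realType} {n : nat} (b : bool).
Local Notation mu := (lebesgue_rV R n).
Local Notation leb := (@lebesgue_measure R).
Variables (u N : 'rV[R]_n -> R) (v : 'I_n -> 'rV[R]_n -> R).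
Hypotheses (iu : mu.-integrable setT (EFin \o u))
  (iv : forall i, mu.-integrable setT (EFin \o v i))
  (uv : forall i, weak_partial_off set0 i (EFin \o u) (v i))
  (mN : measurable_fun setT N) (vN : forall i x, `|v i x| <= N x).

Let mu_ : measurable_fun setT u. Proof. by apply/measurable_EFinP; case/integrableP : iu. Qed.
Let mM := measurable_HL b mu_.
Let mg := measurable_HL b mN.
Let M0 x : (0 <= HL b u x)%E. Proof. exact: HL_ge0. Qed.
Let g0 x : (0 <= HL b N x)%E. Proof. exact: HL_ge0. Qed.
Let aeF : Filter (almost_everywhere mu) := ae_filter_ringOfSetsType mu.

(** Cutting [HL b N] off outside the cube gives a function of finite total integral. By convexity
    its integral along a full line still dominates that of [HL b N] over the segment between two
    points of the cube on that line. *)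
Lemma maximal_integrable_cube c (r : R) :
  (\int[mu]_(x in cube c r) HL b N x < +oo)%E ->
  (\int[mu]_(x in cube c r) HL b u x < +oo)%E.
Proof.
move=> goo; pose g := HL b N \_ (cube c r).
have mgc : measurable_fun setT g.
  by apply/(measurable_restrictT _ _).1; [exact: measurable_cube|exact: measurable_funTS].
have gc0 x : (0 <= g x)%E by rewrite /g patchE; case: ifP.
rewrite cubeE; apply: (upper_gradient_box (g := g)) => //.
- by rewrite -integral_mkcond.
- by apply: filterS (HL_fin_ae b iu) => x.
move=> j x t; rewrite -cubeE => xc xtc.
have mgl : measurable_fun setT (fun s : R => g (x + s *: delta_mx 0 j)).
  by apply: (measurableT_comp mgc); exact: measurable_line_at.
have seg s s' : s <= s' ->
    (forall q, s <= q <= s' -> cube c r (x + q *: delta_mx 0 j)) ->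
    (\int[leb]_(q in `[s, s']) HL b N (x + (q : R) *: delta_mx 0 j)%R <=
     \int[leb]_q g (x + (q : R) *: delta_mx 0 j)%R)%E.
  move=> ss' H; apply: (@le_trans _ _
      (\int[leb]_(q in `[s, s']) g (x + (q : R) *: delta_mx 0 j)%R)%E).
    rewrite le_eqVlt; apply/orP; left; apply/eqP; apply: eq_integral => q.
    by rewrite inE/= in_itv/= => sq; rewrite /g patchE mem_set//; exact: H.
  exact: ge0_subset_integral.
have conv q : Num.min 0 t <= q <= Num.max 0 t -> cube c r (x + q *: delta_mx 0 j).
  move=> qt k; have := xc k; have := xtc k; rewrite !mxE eqxx/=.
  case: (k == j); rewrite ?mulr0 ?mulr1 ?addr0// => /andP[h1 h2] /andP[h3 h4].
  move: qt; rewrite ge_min le_max => /andP[/orP[?|?] /orP[?|?]]; apply/andP; split; lra.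
have [t0|/ltW t0] := leP 0 t.
  have [_] := HL_line (iu) (iv j) (@uv j) mN (@vN j) b x t0.
  rewrite scale0r addr0 => /le_trans; apply; rewrite leeD2l// seg// => q qt; apply: conv.
  by rewrite (min_idPl t0) (max_idPr t0).
have [+ _] := HL_line (iu) (iv j) (@uv j) mN (@vN j) b x t0.
rewrite scale0r addr0 => /le_trans; apply; rewrite leeD2l// seg// => q qt; apply: conv.
by rewrite (min_idPr t0) (max_idPl t0).
Qed.

Variable i : 'I_n.
Local Notation e := (delta_mx 0 i : 'rV[R]_n).
Local Notation h := (maximal_partial i b u N).

Let mh : measurable_fun setT h. Proof. exact: measurable_maximal_partial iu mN. Qed.

(* Both sides are, up to truncation to a set D of finite integral of M|Du|,
   derivatives at t = 0 of the integral of Mu (x + t e) phi x. *)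
Lemma maximal_weak_partial (phi : 'rV[R]_n -> R) : test_function phi ->
  (forall x, supp phi x -> exists2 r, 0 < r & (\int[mu]_(y in cube x r) HL b N y < +oo)%E) ->
  [/\ mu.-integrable setT (fun x => HL b u x * (partial i phi x)%:E)%E,
      mu.-integrable setT (fun x => (h x * phi x)%:E) &
      (- (\int[mu]_x (HL b u x * (partial i phi x)%:E)) = \int[mu]_x (h x * phi x)%:E)%E].
Proof.
move=> tphi reg; have [sphi cphi] := tphi.
have [s [rho [rho0 sP cov]]] := compact_cube_cover cphi reg.
pose D := \big[setU/set0]_(p <- s) cube p.1 p.2.
have mD : measurable D by apply: bigsetU_measurable => p _; exact: measurable_cube.
have sP' p : p \in s -> (\int[mu]_(y in cube p.1 p.2) HL b N y < +oo)%E by exact: sP.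
have Dg : (\int[mu]_(x in D) HL b N x < +oo)%E := integral_bigsetU_lty mg g0 sP'.
have Du : (\int[mu]_(x in D) HL b u x < +oo)%E :=
  integral_bigsetU_lty mM M0 (fun p ps => maximal_integrable_cube (sP' p ps)).
have KD x t : supp phi x -> 0 <= t -> t <= rho -> D (x + t *: e).
  move=> Kx t0 trho; apply: (cov x) => // j; rewrite !mxE eqxx/= [_ + _ - _]addrAC subrr add0r.
  by case: (j == i); rewrite ?mulr0 ?mulr1 ?normr0 ?ger0_norm// ltW.
have KD0 x : supp phi x -> D x.
  by move=> Kx; have := KD x 0 Kx (lexx 0) (ltW rho0); rewrite scale0r addr0.
(* The truncations are integrable on the whole space, as correlations require, and change nothing on
   the translates of [supp phi] by [t e] with [0 <= t <= rho]. *)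
pose w x := fine (HL b u x) * \1_D x; pose q x := h x * \1_D x.
have m1D : measurable_fun setT (\1_D : _ -> R) by exact: measurable_indic.
have mw : measurable_fun setT w.
  apply: measurable_funM m1D.
  exact: (measurableT_comp (@fine_measurable R setT measurableT) mM).
have mq : measurable_fun setT q by exact: measurable_funM.
have iw : mu.-integrable setT (EFin \o w).
  apply/integrableP; split; first exact/measurable_EFinP.
  apply: le_lt_trans Du; rewrite [leRHS]integral_mkcond; apply: ge0_le_integral => //.
  - by apply/measurable_EFinP; exact: measurableT_comp mw.
  - exact: ((measurable_restrictT (HL b u) mD).1 (measurable_funTS mM)).
  - move=> x _; rewrite /w/= patchE indicE; case: ifP => _; last by rewrite mulr0 normr0.
    by rewrite mulr1; have := M0 x; case: (HL b u x) => [r| |]//= r0; rewrite ?normr0 ?leey// ger0_norm.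
have iq : mu.-integrable setT (EFin \o q).
  apply/integrableP; split; first exact/measurable_EFinP.
  apply: le_lt_trans Dg; rewrite [leRHS]integral_mkcond; apply: ge0_le_integral => //.
  - by apply/measurable_EFinP; exact: measurableT_comp mq.
  - exact: ((measurable_restrictT (HL b N) mD).1 (measurable_funTS mg)).
  - move=> x _; rewrite /q/= patchE indicE; case: ifP => _; last by rewrite mulr0 normr0.
    by rewrite mulr1; exact: maximal_partial_le.
have aeu := HL_fin_ae b iu.
have [B HB] := test_bounded tphi; have mphi := test_measurable tphi.
have transl t : 0 <= t -> t <= rho -> {ae mu, forall x, supp phi x ->
    ((w (x + t *: e) - w x)%:E = \int[leb]_(r in `[0%R, t]) (q (x + (r : R) *: e)%R)%:E)%E}.
  move=> t0 trho; have gD0 x : (0 <= (HL b N \_ D) x)%E by rewrite patchE; case: ifP.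
  have mgD : measurable_fun setT (HL b N \_ D).
    exact: ((measurable_restrictT (HL b N) mD).1 (measurable_funTS mg)).
  have gDoo : (\int[mu]_x (HL b N \_ D) x < +oo)%E by rewrite -integral_mkcond; exact: Dg.
  apply: filterS2 aeu (line_integral_lty e 0 rho mgD gD0 gDoo) => x ux gx Kx.
  have inD r : 0 <= r -> r <= rho -> x + r *: e \in D by move=> ? ?; rewrite inE; exact: KD.
  have gx' : (\int[leb]_(s in `[0%R, rho]) HL b N (x + (s : R) *: e)%R < +oo)%E.
    apply: le_lt_trans gx; rewrite le_eqVlt; apply/orP; left; apply/eqP.
    apply: eq_integral => r; rewrite inE/= in_itv/= => /andP[r0 rrho].
    by rewrite patchE inD.
  have := maximal_line_AC iu (iv i) (@uv i) mN (@vN i) ux gx' t0 trho.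
  have wE y : y \in D -> w y = fine (HL b u y) by move=> yD; rewrite /w indicE yD mulr1.
  rewrite (wE _ (inD _ t0 trho)) (wE _ (mem_set (KD0 _ Kx))) => ->.
  apply: eq_integral => r; rewrite inE/= in_itv/= => /andP[r0 rt].
  by rewrite /q indicE inD ?mulr1// (le_trans rt).
(* Integrating the identity along lines against [phi] and applying Fubini gives an integral formula
   for the correlation of [w], for small nonnegative [t] only. *)
have corr t : 0 <= t -> t <= rho -> ((line_corr i w phi t)%:E - (line_corr i w phi 0)%:E =
    \int[leb]_(r in `[0%R, t]) (line_corr i q phi r)%:E)%E.
  move=> t0 trho; have [_ _ Hq] := line_fubini e t iq mphi HB.
  have -> : (\int[leb]_(r in `[0%R, t]) (line_corr i q phi r)%:E =
      \int[mu]_x ((phi x)%:E * \int[leb]_(r in `[0%R, t]) (q (x + (r : R) *: e)%R)%:E))%E.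
    by rewrite Hq; apply: eq_integral => r _; rewrite line_corrE.
  have iwt := integrable_shift (t *: e) iw.
  have i1 := integrable_mul_bounded iwt mphi HB.
  have i2 := integrable_mul_bounded iw mphi HB.
  have -> : ((line_corr i w phi t)%:E = \int[mu]_x (w (x + t *: e)%R * phi x)%:E)%E.
    rewrite line_corrE// -(integral_shift (t *: e) (f := fun x => (w x * phi (x - t *: e)%R)%:E)).
      by apply: eq_integral => x _; rewrite addrK.
    by apply: measurable_int; exact: integrable_mul_test.
  have -> : ((line_corr i w phi 0)%:E = \int[mu]_x (w x * phi x)%:E)%E.
    exact: line_corr0E.
  rewrite -integralB//; apply: ae_eq_integral => //.
  - exact: measurable_int (integrableB measurableT i1 i2).
  - apply: emeasurable_funM; first exact/measurable_EFinP.
    by have [iS _ _] := line_fubini e t iq mphi HB; exact: measurable_int iS.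
  - apply: filterS (transl _ t0 trho) => x H _.
    have [Kx|/supp_out ->] := pselect (supp phi x); last by rewrite !mulr0 mul0e subee.
    by rewrite -H// -EFinB -EFinM; congr EFin; rewrite mulrBr mulrC (mulrC (w x)).
(* The quotients at step [1/(k+1)] of both sides of [corr] agree once the step is below [rho]. The
   left one converges because [phi] is smooth, the right one because the correlation of [q] is
   continuous. *)
have dcorr : - line_corr i w (partial i phi) 0 = line_corr i q phi 0.
  have [dw Ew] := is_derive_line_corr i 0 iw tphi.
  have cq : continuous (line_corr i q phi) by exact: continuous_line_corr.
  (* On [[-1, 1]] the point 0 is interior, so the fundamental theorem of calculus gives a two-sided
     derivative at 0. *)
  have ilc : leb.-integrable `[-1 : R, 1 : R] (EFin \o line_corr i q phi).
    apply: continuous_compact_integrable; first exact: segment_compact.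
    exact: continuous_subspaceT.
  have [dF EF] := @continuous_FTC1_closed R (line_corr i q phi) (-1) 0 1 ltr01 ilc
    (ltrN10 R) (cq 0).
  have c1 := cvg_diff_quotient dw (etrans (derive1E _ _) Ew).
  have c2 := cvg_diff_quotient dF EF.
  suff c2' : (fun k : nat => k.+1%:R * (line_corr i w phi (0 + k.+1%:R^-1) - line_corr i w phi 0))
      @ \oo --> line_corr i q phi 0 by exact: (cvg_unique (@Rhausdorff R) c1 c2').
  apply: cvg_trans c2; apply: near_eq_cvg; near=> k.
  have krho : k.+1%:R^-1 <= rho.
    by apply: ltW; near: k; exact: (near_infty_natSinv_lt (PosNum rho0)).
  have k1 : k.+1%:R^-1 <= 1 :> R by rewrite invf_le1// ler1n.
  have k0 : 0 <= k.+1%:R^-1 :> R by rewrite invr_ge0.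
  rewrite /= !add0r; congr (_ * _); apply/esym/EFin_inj; rewrite EFinB corr//.
  have -> : (\int[leb]_(t in `[-1, k.+1%:R^-1]) line_corr i q phi t -
      \int[leb]_(t in `[-1, 0]) line_corr i q phi t)%R =
      (\int[leb]_(t in `]0%R, k.+1%:R^-1]) line_corr i q phi t)%R.
    by apply: Rintegral_itvB; rewrite ?bnd_simp//; apply: integrableS ilc => //; apply: subset_itvl; rewrite bnd_simp.
  rewrite Rintegral_itv_obnd_cbnd; last first.
    by apply: integrableS ilc => //; apply: subset_itv; rewrite bnd_simp ?lerN10.
  rewrite /Rintegral fineK//; apply: integrable_fin_num => //.
  by apply: integrableS ilc => //; apply: subset_itv; rewrite bnd_simp ?lerN10.
have tp := test_partial i tphi.
have iwp : mu.-integrable setT (fun x => (w x * partial i phi x)%:E).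
  by under eq_fun => x do rewrite -[x in partial i phi x]addr0; exact: integrable_mul_test.
have iqp : mu.-integrable setT (fun x => (q x * phi x)%:E).
  by under eq_fun => x do rewrite -[x in phi x]addr0; exact: integrable_mul_test.
have hqE x : h x * phi x = q x * phi x.
  rewrite /q indicE; have [Kx|/supp_out ->] := pselect (supp phi x); last by rewrite !mulr0.
  by rewrite mem_set ?mulr1//; exact: KD0.
(* [HL b u] may be infinite on a null set, where [fine] returns 0, hence an equality almost
   everywhere only. *)
have ueq : {ae mu, forall x, setT x ->
    (HL b u x * (partial i phi x)%:E = (w x * partial i phi x)%:E)%E}.
  apply: filterS aeu => x ux _.
  have [Kx|/(partial_supp i) ->] := pselect (supp phi x); last by rewrite mule0 mulr0.
  rewrite /w indicE mem_set ?mulr1; last exact: KD0.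
  by rewrite EFinM fineK// ge0_fin_numE.
have mup : measurable_fun setT (fun x => HL b u x * (partial i phi x)%:E)%E.
  by apply: emeasurable_funM; [exact: mM|apply/measurable_EFinP; exact: test_measurable].
have mwp := measurable_int _ iwp.
have Eu := ae_eq_integral _ _ measurableT mup mwp ueq.
split.
- apply/integrableP; split; first exact: mup.
  case/integrableP : iwp => _; apply: le_lt_trans.
  rewrite le_eqVlt; apply/orP; left; apply/eqP; apply: ae_eq_integral => //.
  + exact: measurableT_comp.
  + exact: measurableT_comp.
  + by apply: filterS ueq => x H xT; rewrite H.
- by under eq_fun do rewrite hqE.
- rewrite Eu; under [RHS]eq_integral do rewrite hqE.
  by rewrite -(line_corr0E i iw tp) -(line_corr0E i iq tphi) -EFinN dcorr.
Unshelve. all: by end_near. Qed.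

Lemma weak_L1_maximal_partial : mu.-integrable setT (EFin \o N) -> weak_L1 h.
Proof.
move=> iN; split; first exact: mh.
apply: (@le_lt_trans _ _ ((3 ^+ n)%:E * \int[mu]_y `|N y|%:E)%E); last first.
  rewrite lte_mul_pinfty ?lee_fin ?exprn_ge0//.
  by case/integrableP : iN.
apply: ge_ereal_sup => _ [l /= l0 <-]; apply: le_trans (maximal_weak_type mN l0).
rewrite lee_pmul2l//; apply: le_measure; rewrite ?inE.
- rewrite -[X in measurable X]setTI (_ : [set x | _] = (fun x => `|h x|) @^-1` `]l, +oo[%classic).
    by apply: (measurableT_comp (@normr_measurable R setT) mh).
  by apply/seteqP; split => x /=; rewrite in_itv/= andbT.
- by apply: open_measurable_rV; exact: open_HL_noncentred.
move=> x /= lh; apply: (@lt_le_trans _ _ `|h x|%:E); first by rewrite lte_fin.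
apply: le_trans (maximal_partial_le _ _ _ _ _) _; exact: HL_le_noncentred.
Qed.

End weak_derivative_of_maximal_function.

Lemma limf_einf_lty (R : realType) (n : nat) (f : 'rV[R]_n -> \bar R) x :
  measurable_fun setT f -> (forall y, (0 <= f y)%E) ->
  limf_einf (fun d : R => \int[lebesgue_rV R n]_(y in eball x d) f y)%E 0^'+ <> +oo%E ->
  exists2 r, 0 < r & (\int[lebesgue_rV R n]_(y in cube x r) f y < +oo)%E.
Proof.
move=> mf f0 fx.
have [d d0 dx] : exists2 d : R, 0 < d &
    (\int[lebesgue_rV R n]_(y in eball x d) f y < +oo)%E.
  (* If all balls had infinite integral, so would the infimum over radii in []0, 1[], and the lower
     limit at 0 would be infinite. *)
  apply: contrapT => H; apply: fx; apply/eqP; rewrite -leye_eq limf_einfE.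
  apply: ereal_sup_ubound; exists `]0, 1[%classic.
    near=> d; rewrite /= in_itv/=; apply/andP; split; first by near: d; exact: nbhs_right_gt.
    by near: d; exact: nbhs_right_lt.
  apply/eqP; rewrite -leye_eq; apply: le_ereal_inf_tmp => _ [d /= + <-].
  rewrite in_itv/= => /andP[d0 _]; rewrite leye_eq; apply/negPn/negP => dx.
  by apply: H; exists d => //; rewrite ltey.
(* The Euclidean norm is at most the sum of the [n] coordinates, here at most [n r]; dividing by
   [n + 1] makes this strictly less than [d]. *)
pose r := d / (n.+1)%:R.
have r0 : 0 < r by rewrite divr_gt0.
exists r => //; apply: le_lt_trans dx; apply: ge0_subset_integral => //.
- exact: measurable_cube.
- have me : measurable_fun setT (fun y : 'rV[R]_n => enorm (y - x)).
    apply: measurable_enorm => i.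
    exact: (measurableT_comp (measurable_rV_coord i) (measurable_shift (- x))).
  rewrite -[X in measurable X]setTI (_ : eball x d = (fun y => enorm (y - x)) @^-1` `]-oo, d[%classic).
    exact: me.
  by apply/seteqP; split => y /=; rewrite in_itv.
- exact: measurable_funTS.
move=> y yx; apply: (le_lt_trans (enorm_le_sum _)).
apply: (@le_lt_trans _ _ (\sum_(i < n) r)).
  by apply: ler_sum => i _; have := yx i; rewrite !mxE -ltr_distlC distrC => /ltW.
rewrite sumr_const card_ord /r -[_ *+ n]mulr_natr mulrAC ltr_pdivrMr// ltr_pM2l//.
by rewrite ltr_nat.
Unshelve. all: by end_near. Qed.

Theorem corollary4p1 (R : realType) (n : nat) (n_gt1 : (1 < n)%N) :
  exists C : R,
  forall (centred : bool) (u : 'rV[R]_n -> R) (Du : 'rV[R]_n -> 'rV[R]_n),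
  W11_gradient u Du ->
  let M := HL centred in
  let norm_Du := fun x => enorm (Du x) in
  let A := [set x | limf_einf
    (fun d : R => \int[lebesgue_rV R n]_(y in eball x d) M norm_Du y)%E 0^'+
    = +oo%E] in
  forall i : 'I_n, exists h : 'rV[R]_n -> R,
  [/\ weak_L1 h,
      weak_partial_off A i (M u) h &
      {ae lebesgue_rV R n, forall x, (`|h x|%:E <= C%:E * M norm_Du x)%E}].
Proof.
exists 1 => b u Du [iu WDu] M N A i.
have iv j := (WDu j).1; have uv j := (WDu j).2.
have mDu j : measurable_fun setT (fun x => Du x 0 j).
  by apply/measurable_EFinP; case/integrableP : (iv j).
have mN : measurable_fun setT N by exact: measurable_enorm.
have vN j x : `|Du x 0 j| <= N x by exact: enorm_coord.
have iN : (lebesgue_rV R n).-integrable setT (EFin \o N).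
  have iS : (lebesgue_rV R n).-integrable setT (fun x => \sum_(j < n) `|(Du x 0 j)%:E|)%E.
    by apply: integrable_sum => // j _; exact: integrable_abse (iv j).
  apply: le_integrable iS => //; first exact/measurable_EFinP.
  move=> x _; rewrite abse_EFin ger0_norm ?enorm_ge0//.
  apply: le_trans (lee_abs _); under eq_bigr do rewrite abse_EFin.
  by rewrite sumEFin lee_fin; exact: enorm_le_sum.
exists (maximal_partial i b u N); split.
- exact: weak_L1_maximal_partial iu mN i iN.
- move=> phi tphi phiA; apply: (maximal_weak_partial iu iv uv mN vN) => // x Kx.
  apply: limf_einf_lty => [||/= Ax].
  + exact: measurable_HL.
  + by move=> y; exact: HL_ge0.
  + by have : (supp phi `&` A) x by []; rewrite phiA.
- by apply: aeW => x; rewrite mul1e; exact: maximal_partial_le.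
Qed.
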